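(* For $k\in\mathbb{Z}^+$ and $p\in[1,\infty)$, there exists a $(p,k)$-isolating parallelepiped if and only if either (1) $p\notin 2\mathbb{Z}$ or (2) $p\ge k$. Moreover, there is an algorithm that on input $k\in\mathbb{Z}^+$ and any computable $p\in[1,\infty)$ with either (1) $p\notin2\mathbb{Z}$ or (2) $p\ge k$, outputs $V\in\mathbb{R}^{2^k\times k}$ and $\vec t^*\in\mathbb{R}^{2^k}$ that define a $(p,k)$-isolating parallelepiped.
   Context: $\|\vec x\|_p=(\sum_i|x_i|^p)^{1/p}$. For $1\le p\le\infty$ and integer $k\ge1$, $V\in\mathbb{R}^{d^*\times k}$ and $\vec t^*\in\mathbb{R}^{d^*}$ define a $(p,k)$-isolating parallelepiped if $\|V\vec x-\vec t^*\|_p=1$ for all $\vec x\in\{0,1\}^k\setminus\{\vec 0\}$ and $\|\vec t^*\|_p>1$. *)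

(* Defs.v *)
From HB Require Import structures.
From mathcomp Require Import all_boot all_order all_algebra.
From mathcomp Require Import reals exp.

Set Implicit Arguments.
Unset Strict Implicit.
Unset Printing Implicit Defensive.

Import Order.TTheory GRing.Theory Num.Theory.
Local Open Scope ring_scope.

(* Only finite exponents occur in the theorem.  [0 `^ p = 0] for [p != 0]. *)
Definition lpnorm (R : realType) (p : R) (d : nat) (x : 'cV[R]_d) : R :=
  (\sum_(i < d) `|x i 0| `^ p) `^ p^-1.

Definition isolating_parallelepiped (R : realType) (p : R) (k d : nat)
    (V : 'M[R]_(d, k)) (t : 'cV[R]_d) : Prop :=
  (forall x : 'cV[R]_k,
      (forall i, x i 0 = 0 \/ x i 0 = 1) -> x <> 0 ->
      lpnorm p (V *m x - t) = 1)
  /\ 1 < lpnorm p t.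

Definition even_integer (R : realType) (p : R) : Prop :=
  exists m : int, p = 2 * m%:~R.

(* Kleene's partial recursive functions relative to an oracle [nat -> nat].
   Programs have no fixed arity: they run on a list of arguments, and a missing
   argument is read as 0 (primitive recursion on the empty list diverges). *)
Inductive prog : Type :=
| PZero
| PSucc
| PProj of nat
| POracle
| PComp of prog & seq prog
| PRec of prog & prog
| PMu of prog.

(* [eval phi e v y]: with oracle [phi], [e] halts on arguments [v] with value
   [y].  In [ev_mu], [f] must be defined at every [z < y], with the nonzero
   value [(m z).+1]. *)
Inductive eval (phi : nat -> nat) : prog -> seq nat -> nat -> Prop :=
| ev_zero v : eval phi PZero v 0%N
| ev_succ v : eval phi PSucc v (nth 0%N v 0).+1
| ev_proj i v : eval phi (PProj i) v (nth 0%N v i)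
| ev_oracle v : eval phi POracle v (phi (nth 0%N v 0))
| ev_comp f gs v w y :
    evals phi gs v w -> eval phi f w y -> eval phi (PComp f gs) v y
| ev_rec0 f g v y :
    eval phi f v y -> eval phi (PRec f g) (0%N :: v) y
| ev_recS f g n v r y :
    eval phi (PRec f g) (n :: v) r -> eval phi g [:: n, r & v] y ->
    eval phi (PRec f g) (n.+1 :: v) y
| ev_mu f v y (m : nat -> nat) :
    (forall z : nat, (z < y)%N -> eval phi f (z :: v) (m z).+1) ->
    eval phi f (y :: v) 0%N -> eval phi (PMu f) v y
with evals (phi : nat -> nat) : seq prog -> seq nat -> seq nat -> Prop :=
| evs_nil v : evals phi [::] v [::]
| evs_cons g gs v y w :
    eval phi g v y -> evals phi gs v w -> evals phi (g :: gs) v (y :: w).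

(* The constant zero oracle gives ordinary, oracle-free computability. *)
Definition computable (f : nat -> nat) : Prop :=
  exists e : prog, forall n : nat, eval (fun=> 0%N) e [:: n] (f n).

(* The bijection 0, 1, 2, 3, 4, ... |-> 0, -1, 1, -2, 2, ... *)
Definition int_of_code (c : nat) : int :=
  if odd c then Negz c./2 else Posz c./2.

(* [phi] is a name of the real [x]: on input [n] it returns (the code of) the
   numerator of a dyadic approximation of [x] to within [2 ^- n]. A real is
   computable iff it has a computable name. *)
Definition represents (R : realType) (phi : nat -> nat) (x : R) : Prop :=
  forall n : nat, `|(int_of_code (phi n))%:~R / 2 ^+ n - x| <= 2 ^- n.

(* [A], run with oracle [phi] and input [k], outputs the real matrix [M]: it
   computes a name of every entry, uniformly in the position of the entry. *)
Definition outputs_matrix (R : realType) (phi : nat -> nat) (A : prog)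
    (k : nat) (m n : nat) (M : 'M[R]_(m, n)) : Prop :=
  forall (i : 'I_m) (j : 'I_n), exists psi : nat -> nat,
    represents psi (M i j) /\
    forall q : nat, eval phi A [:: k; nat_of_ord i; nat_of_ord j; q] (psi q).

(* Main.v *)
From HB Require Import structures.
From mathcomp Require Import all_boot all_order all_algebra.
From mathcomp Require Import all_classical reals topology normedtype sequences.
From mathcomp Require Import derive realfun exp.
From mathcomp Require Import ring lra.
Require Import Defs.

(** Necessity: for even [p < k], each coordinate of [V x - t] raised to the power
    [p] is a polynomial of degree less than [k] in [x], so its alternating sum
    over the cube [{0,1}^k] vanishes; summing the coordinates,
    [|V 0 - t|^p = 1].

    Sufficiency: index the rows by [u] in [{0,1}^k] and put
    [V_(u,j) = 2 b_u (-1)^(u_j)], [t_u = b_u (h - 2 |u|)], so that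
    [|V x - t|^p = sum_u b_u^p |2 |u + x| - h|^p] is a convolution on the group
    [(Z/2)^k].  The characters [chi_S] diagonalize it, with eigenvalues
    [lam_S = sum_w chi_S(w) |2 |w| - h|^p].  When none of them vanishes, weights
    [b_u^p] making this convolution constant except for a bump at [x = 0] are
    polynomials in the [lam_S].  As [h -> 0+], [lam_S] equals [h^p] plus a
    function that is analytic at [0]; repeated use of Rolle's theorem shows that
    it has no zeros accumulating at [0].  (For even [p >= k] it is a polynomial,
    nonzero because the moments of [chi_S] up to order [k] do not all vanish.)

    Computability: rational powers are compared through integer powers, which
    gives rational enclosures of all the quantities above, uniformly in a name
    of [p].  Both a good offset [h = 1 / (m + 2)] and the approximations of the
    entries are found by unbounded search for a certified strict inequality, so
    that no case distinction on [p] is needed. *)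

Set Implicit Arguments.
Unset Strict Implicit.
Unset Printing Implicit Defensive.

Import Order.TTheory GRing.Theory Num.Theory.
Import numFieldNormedType.Exports.

Local Open Scope nat_scope.

(** * Computable functions on natural numbers *)

(* The arity [a] is fixed because a program cannot pass on an argument list of
   unknown length; [phi] ranges over all oracles. *)
Definition cnat (a : nat) (F : (nat -> nat) -> seq nat -> nat) : Prop :=
  exists e, forall phi v, size v = a -> eval phi e v (F phi v).

Definition cbool (a : nat) (b : (nat -> nat) -> seq nat -> bool) : Prop :=
  cnat a (fun phi v => b phi v).

Lemma cnat_ext a F G :
  (forall phi v, size v = a -> F phi v = G phi v) -> cnat a F -> cnat a G.
Proof. by move=> FG [e he]; exists e => phi v sv; rewrite -FG //; exact: he. Qed.

Lemma cnat_nth a i : cnat a (fun _ v => nth 0 v i).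
Proof. by exists (PProj i) => phi v _; constructor. Qed.

Lemma cnat_const a c : cnat a (fun _ _ => c).
Proof.
elim: c => [|c [e he]]; first by exists PZero => phi v _; constructor.
exists (PComp PSucc [:: e]) => phi v sv; apply: (@ev_comp _ _ _ _ [:: c]).
  by constructor; [exact: he | constructor].
exact: ev_succ.
Qed.

Lemma cnat_list a b (G : (nat -> nat) -> seq nat -> seq nat) :
  (forall j, j < b -> cnat a (fun phi v => nth 0 (G phi v) j)) ->
  exists es, forall phi v, size v = a -> size (G phi v) = b ->
    evals phi es v (G phi v).
Proof.
elim: b G => [|b IHb] G hG.
  by exists [::] => phi v _ /size0nil ->; constructor.
have [e he] := hG 0 isT.
have [es hes] := IHb (fun phi v => behead (G phi v)) (fun j jb =>
  cnat_ext (fun phi v _ => esym (nth_behead _ _ _)) (hG j.+1 jb)).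
exists (e :: es) => phi v sv sG; move: (he phi v sv) (hes phi v sv).
by case: (G phi v) sG => [|x s] //= [sG] ? ?; constructor => //; auto.
Qed.

Lemma cnat_subst a b (G : (nat -> nat) -> seq nat -> seq nat) F :
  (forall phi v, size v = a -> size (G phi v) = b) ->
  (forall j, j < b -> cnat a (fun phi v => nth 0 (G phi v) j)) ->
  cnat b F -> cnat a (fun phi v => F phi (G phi v)).
Proof.
move=> sG /cnat_list[es hes] [e he]; exists (PComp e es) => phi v sv.
by apply: ev_comp; [apply: hes; auto | apply: he; auto].
Qed.

Lemma cnat_behead a F : cnat a F -> cnat a.+1 (fun phi v => F phi (behead v)).
Proof.
apply: (@cnat_subst a.+1 a (fun _ v => behead v)) => [phi v|j _].
  by rewrite size_behead => ->.
by apply: cnat_ext (cnat_nth a.+1 j.+1) => phi v _; rewrite nth_behead.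
Qed.

(** A recursion step receives the counter, the accumulator and the parameters; forgetting the
    accumulator lets a function of the counter be used inside it. *)
Lemma cnat_skip1 a F : cnat a.+1 F ->
  cnat a.+2 (fun phi v => F phi (nth 0 v 0 :: behead (behead v))).
Proof.
apply: cnat_subst => [phi v|[|j] _] /=; [|exact: cnat_nth|].
  by rewrite !size_behead => ->.
by apply: cnat_ext (cnat_nth _ j.+2) => phi v _; rewrite !nth_behead.
Qed.

Lemma cnat_swap a F : cnat a.+2 F -> cnat a.+2 (fun phi v =>
  F phi [:: nth 0 (behead v) 0, nth 0 v 0 & behead (behead v)]).
Proof.
apply: cnat_subst => [phi v|[|[|j]] _] /=; first by rewrite !size_behead => ->.
- by apply: cnat_ext (cnat_nth _ 1) => phi v _; rewrite !nth_behead.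
- exact: cnat_nth.
by apply: cnat_ext (cnat_nth _ j.+2) => phi v _; rewrite !nth_behead.
Qed.

Lemma cnat_rec a N F (G : (nat -> nat) -> seq nat -> nat -> nat -> nat) :
  cnat a N -> cnat a F ->
  cnat a.+2 (fun phi v => G phi (behead (behead v)) (nth 0 v 0) (nth 0 v 1)) ->
  cnat a (fun phi v =>
    nat_rect (fun=> nat) (F phi v) (fun n r => G phi v n r) (N phi v)).
Proof.
move=> cN [f hf] [g hg].
apply: (@cnat_subst a a.+1 (fun phi v => N phi v :: v) (fun phi v =>
  nat_rect (fun=> nat) (F phi (behead v)) (fun n r => G phi (behead v) n r)
    (nth 0 v 0))).
- by move=> phi v /= ->.
- by case=> [_|j _] //=; exact: cnat_nth.
exists (PRec f g) => phi [|n v] //= [sv].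
elim: n => [|n IHn] /=; first by apply: ev_rec0; exact: hf.
by apply: ev_recS IHn _; apply: (hg phi [:: n, _ & v]); rewrite /= sv.
Qed.

Lemma cnat_S a F : cnat a F -> cnat a (fun phi v => (F phi v).+1).
Proof.
move=> [e he]; exists (PComp PSucc [:: e]) => phi v sv.
apply: (@ev_comp _ _ _ _ [:: F phi v]); last exact: ev_succ.
by constructor; [exact: he | constructor].
Qed.

Lemma cnat_oracle a F : cnat a F -> cnat a (fun phi v => phi (F phi v)).
Proof.
move=> [e he]; exists (PComp POracle [:: e]) => phi v sv.
apply: (@ev_comp _ _ _ _ [:: F phi v]); last exact: ev_oracle.
by constructor; [exact: he | constructor].
Qed.

Lemma cnat_pred a F : cnat a F -> cnat a (fun phi v => (F phi v).-1).
Proof.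
move=> cF; apply: cnat_ext (cnat_rec (G := fun _ _ n _ => n) cF
  (cnat_const a 0) (cnat_nth _ 0)) => phi v _.
by case: (F phi v).
Qed.

Lemma cnat_add a F G :
  cnat a F -> cnat a G -> cnat a (fun phi v => F phi v + G phi v).
Proof.
move=> cF cG; apply: cnat_ext (cnat_rec (G := fun _ _ _ r => r.+1) cG cF
  (cnat_S (cnat_nth _ 1))) => phi v _.
by elim: (G phi v) => [|n IHn] /=; rewrite ?addn0 ?addnS ?IHn.
Qed.

Lemma cnat_sub a F G :
  cnat a F -> cnat a G -> cnat a (fun phi v => F phi v - G phi v).
Proof.
move=> cF cG; apply: cnat_ext (cnat_rec (G := fun _ _ _ r => r.-1) cG cF
  (cnat_pred (cnat_nth _ 1))) => phi v _.
by elim: (G phi v) => [|n IHn] /=; rewrite ?subn0 ?subnS ?IHn.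
Qed.

Lemma cnat_sum a N (G : (nat -> nat) -> seq nat -> nat -> nat) :
  cnat a N -> cnat a.+1 (fun phi v => G phi (behead v) (nth 0 v 0)) ->
  cnat a (fun phi v => \sum_(0 <= i < N phi v) G phi v i).
Proof.
move=> cN cG.
have cG2 : cnat a.+2 (fun phi v => G phi (behead (behead v)) (nth 0 v 0)).
  exact: (cnat_skip1 cG).
apply: cnat_ext (cnat_rec (G := fun phi v n r => r + G phi v n) cN
  (cnat_const a 0) (cnat_add (cnat_nth _ 1) cG2)) => phi v _.
elim: (N phi v) => [|n IHn] /=; first by rewrite big_geq.
by rewrite big_nat_recr //= -IHn.
Qed.

Lemma cnat_mul a F G :
  cnat a F -> cnat a G -> cnat a (fun phi v => F phi v * G phi v).
Proof.
move=> cF cG; apply: cnat_ext (cnat_sum (G := fun phi v _ => G phi v) cF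
  (cnat_behead cG)) => phi v _.
by rewrite sum_nat_const_nat subn0.
Qed.

Lemma cnat_prod a N (G : (nat -> nat) -> seq nat -> nat -> nat) :
  cnat a N -> cnat a.+1 (fun phi v => G phi (behead v) (nth 0 v 0)) ->
  cnat a (fun phi v => \prod_(0 <= i < N phi v) G phi v i).
Proof.
move=> cN cG.
have cG2 : cnat a.+2 (fun phi v => G phi (behead (behead v)) (nth 0 v 0)).
  exact: (cnat_skip1 cG).
apply: cnat_ext (cnat_rec (G := fun phi v n r => r * G phi v n) cN
  (cnat_const a 1) (cnat_mul (cnat_nth _ 1) cG2)) => phi v _.
elim: (N phi v) => [|n IHn] /=; first by rewrite big_geq.
by rewrite big_nat_recr //= -IHn.
Qed.

Lemma cnat_exp a F G :
  cnat a F -> cnat a G -> cnat a (fun phi v => F phi v ^ G phi v).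
Proof.
move=> cF cG; apply: cnat_ext (cnat_prod (G := fun phi v _ => F phi v) cG
  (cnat_behead cF)) => phi v _.
by rewrite prod_nat_const_nat subn0.
Qed.

Lemma cbool_neg a b : cbool a b -> cbool a (fun phi v => ~~ b phi v).
Proof.
move=> cb; apply: cnat_ext (cnat_sub (cnat_const a 1) cb) => phi v _.
by case: (b phi v).
Qed.

Lemma cbool_and a b c :
  cbool a b -> cbool a c -> cbool a (fun phi v => b phi v && c phi v).
Proof.
move=> cb cc; apply: cnat_ext (cnat_mul cb cc) => phi v _.
by case: (b phi v); case: (c phi v).
Qed.

Lemma cbool_leq a F G :
  cnat a F -> cnat a G -> cbool a (fun phi v => F phi v <= G phi v).
Proof.
move=> cF cG; apply: cnat_ext (cnat_sub (cnat_const a 1) (cnat_sub cF cG)).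
by move=> phi v _; rewrite /leq; case: (F phi v - G phi v).
Qed.

Lemma cbool_eq a F G :
  cnat a F -> cnat a G -> cbool a (fun phi v => F phi v == G phi v).
Proof.
move=> cF cG; apply: cnat_ext (cbool_and (cbool_leq cF cG) (cbool_leq cG cF)).
by move=> phi v _; rewrite -eqn_leq.
Qed.

Lemma cnat_if a b F G : cbool a b -> cnat a F -> cnat a G ->
  cnat a (fun phi v => if b phi v then F phi v else G phi v).
Proof.
move=> cb cF cG; apply: cnat_ext (cnat_add (cnat_mul cb cF)
  (cnat_mul (cbool_neg cb) cG)) => phi v _.
by case: (b phi v); rewrite /= ?mul0n ?mul1n ?addn0.
Qed.

Lemma cbool_odd a F : cnat a F -> cbool a (fun phi v => odd (F phi v)).
Proof.
move=> cF; apply: cnat_ext (cnat_rec (G := fun _ _ _ r => 1 - r) cF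
  (cnat_const a 0) (cnat_sub (cnat_const _ 1) (cnat_nth _ 1))) => phi v _.
by elim: (F phi v) => //= n ->; case: (odd n).
Qed.

Lemma sum_nat_lt (q m : nat) :
  q <= m -> \sum_(0 <= i < m) (i < q) = q.
Proof.
move=> qm; rewrite (big_cat_nat _ qm) //= big_nat.
rewrite (eq_bigr (fun=> 1)); last by move=> i /andP[_ ->].
rewrite -big_nat sum_nat_const_nat subn0 muln1.
by rewrite big_nat big1 ?addn0 // => i /andP[qi _]; rewrite ltnNge qi.
Qed.

(** The quotient is the number of [i < F] with [(i + 1) G <= F]; the guard [0 < G] yields the
    convention that division by 0 gives 0. *)
Lemma cnat_div a F G :
  cnat a F -> cnat a G -> cnat a (fun phi v => F phi v %/ G phi v).
Proof.
move=> cF cG; apply: cnat_ext (cnat_sum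
  (G := fun phi v i => (0 < G phi v) && (i.+1 * G phi v <= F phi v)) cF
  (cbool_and (cbool_leq (cnat_const _ 1) (cnat_behead cG))
    (cbool_leq (cnat_mul (cnat_S (cnat_nth _ 0)) (cnat_behead cG))
      (cnat_behead cF)))) => phi v _.
move: (F phi v) (G phi v) => m [|d].
  by rewrite divn0 big1_seq // => i _.
rewrite (eq_bigr (fun i => (i < m %/ d.+1) : nat)); last first.
  by move=> i _; rewrite leq_divRL.
by rewrite sum_nat_lt // leq_div.
Qed.

Lemma cbool_exists a N (b : (nat -> nat) -> seq nat -> nat -> bool) :
  cnat a N -> cbool a.+1 (fun phi v => b phi (behead v) (nth 0 v 0)) ->
  cbool a (fun phi v => has (b phi v) (iota 0 (N phi v))).
Proof.
move=> cN cb; apply: cnat_ext (cbool_leq (cnat_const _ 1)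
  (cnat_sum (G := fun phi v i => b phi v i) cN cb)) => phi v _.
by rewrite has_count -sumn_count sumnE big_map /index_iota subn0.
Qed.

Lemma cnat_find a N (b : (nat -> nat) -> seq nat -> nat -> bool) :
  cnat a N -> cbool a.+1 (fun phi v => b phi (behead v) (nth 0 v 0)) ->
  cnat a (fun phi v => find (b phi v) (iota 0 (N phi v))).
Proof.
move=> cN cb.
(* After [n] rounds the accumulator is the first hit below [n], or [n] if there is none; so [r < n]
   says that a hit is already recorded. *)
apply: cnat_ext (cnat_rec (G := fun phi v n r =>
  if (r < n) || b phi v n then r else r.+1) cN (cnat_const a 0) _) => [phi v _|].
  elim: (N phi v) => [//|n IHn].
  rewrite -[in RHS]addn1 iotaD find_cat size_iota add0n [LHS]/= [find _ [:: n]]/=.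
  rewrite IHn.
  have := find_size (b phi v) (iota 0 n); rewrite size_iota.
  have := has_find (b phi v) (iota 0 n); rewrite size_iota.
  set r := find _ _ => -> le_rn.
  case: ltnP => //= le_nr; have -> : r = n by apply/eqP; rewrite eqn_leq le_rn.
  by case: ifP => _; rewrite ?addn0 ?addn1.
apply: cnat_if; [|exact: cnat_nth|exact/cnat_S/cnat_nth].
have cb2 : cbool a.+2 (fun phi v => b phi (behead (behead v)) (nth 0 v 0)).
  exact: (cnat_skip1 cb).
apply: cnat_ext (cbool_neg (cbool_and (cbool_neg (cbool_leq
  (cnat_S (cnat_nth _ 1)) (cnat_nth _ 0))) (cbool_neg cb2))) => phi v _.
by rewrite negb_and !negbK.
Qed.

Lemma cnat_half a F : cnat a F -> cnat a (fun phi v => (F phi v)./2).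
Proof.
move=> cF; apply: cnat_ext (cnat_div cF (cnat_const a 2)) => phi v _.
by rewrite divn2.
Qed.

Lemma eval_search a b : cbool a.+1 b -> exists e, forall phi v, size v = a ->
  (exists z, b phi (z :: v)) -> exists2 z, b phi (z :: v) & eval phi e v z.
Proof.
move=> /cbool_neg[e he]; exists (PMu e) => phi v sv ex_b.
case: (ex_minnP ex_b) => y by_ min_y; exists y => //.
(* Below the least witness the negated test has value 1, the successor of 0. *)
apply: (@ev_mu _ _ _ _ (fun=> 0)) => [z zy|].
  have := he phi (z :: v); rewrite /= sv => /(_ erefl).
  by case: (boolP (b phi (z :: v))) => [/min_y|//]; rewrite leqNgt zy.
by have := he phi (y :: v); rewrite /= sv by_ => /(_ erefl).
Qed.

(** Sequencing for an intermediate value known only through its evaluation, as after an unbounded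
    search; [cnat] covers total functions only. *)
Lemma eval_bind a F ez : cnat a.+1 F -> exists e, forall phi v z,
  size v = a -> eval phi ez v z -> eval phi e v (F phi (z :: v)).
Proof.
move=> [f hf].
have [es hes] : exists es, forall phi v, size v = a -> size v = a ->
    evals phi es v v.
  by apply: (@cnat_list a a (fun _ v => v)) => j _; exact: cnat_nth.
exists (PComp f (ez :: es)) => phi v z sv hz; apply: (@ev_comp _ _ _ _ (z :: v)).
  by constructor => //; exact: hes.
by apply: hf; rewrite /= sv.
Qed.

(* A witness [c] of a property that is certified at all large precisions is
   found by searching for a precision [z] that certifies some [c < z]. *)
Lemma eval_search_certified a b : cbool a.+2 b -> exists e, forall phi v,
  size v = a ->
  (exists c N, forall n, (N <= n)%N -> b phi [:: n, c & v]) ->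
  exists c n, b phi [:: n, c & v] /\ eval phi e v c.
Proof.
move=> cb.
pose t phi v c := b phi [:: nth 0%N v 0, c & behead v].
have ct : cbool a.+2 (fun phi v => t phi (behead v) (nth 0%N v 0)).
  exact: (cnat_swap cb).
have [ez hz] := eval_search (cbool_exists (cnat_nth a.+1 0) ct).
have [e he] := eval_bind ez (cnat_find (cnat_nth a.+1 0) ct).
exists e => phi v sv [c [N hN]].
have [|z has_z ev_z] := hz phi v sv.
  (* This bound lets the inner search reach [c] and is also a precision that certifies it. *)
  exists (maxn c.+1 N); apply/hasP; exists c => /=.
    by rewrite mem_iota leq_maxl.
  by apply: hN; rewrite leq_maxr.
have := he phi v z sv ev_z => /= ev_e.
exists (find (t phi (z :: v)) (iota 0 z)), z; split; last exact: ev_e.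
have := nth_find 0%N has_z; rewrite /= nth_iota // -[X in (_ < X)%N](size_iota 0 z).
by rewrite -has_find.
Qed.

Local Open Scope classical_set_scope.
Local Open Scope ring_scope.

(** * Computable rationals and real enclosures *)

Section RationalValued.
Variable R : realType.
Implicit Types F G : (nat -> nat) -> seq nat -> R.

(** The numerator is a difference of naturals, which avoids coding integers; the successor keeps the
    denominator nonzero. *)
Definition crat (a : nat) (F : (nat -> nat) -> seq nat -> R) : Prop :=
  exists x y d, [/\ cnat a x, cnat a y, cnat a d & forall phi v, size v = a ->
    F phi v = ((x phi v)%:R - (y phi v)%:R) / (d phi v).+1%:R].

Lemma natSr_neq0 n : n.+1%:R != 0 :> R.
Proof. by rewrite pnatr_eq0. Qed.

Lemma crat_ext a F G :
  (forall phi v, size v = a -> F phi v = G phi v) -> crat a F -> crat a G.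
Proof.
move=> FG [x [y [d [cx cy cd hF]]]]; exists x, y, d; split=> // phi v sv.
by rewrite -FG // hF.
Qed.

Lemma crat_behead a F : crat a F -> crat a.+1 (fun phi v => F phi (behead v)).
Proof.
move=> [x [y [d [cx cy cd hF]]]].
exists (fun phi v => x phi (behead v)), (fun phi v => y phi (behead v)),
  (fun phi v => d phi (behead v)); split; try exact: cnat_behead.
by move=> phi v sv; rewrite hF // size_behead sv.
Qed.

(** Approximations take the precision as first argument, while a bounded sum or product puts its
    index first; the swap reconciles the two. *)
Lemma crat_swap a F : crat a.+2 F -> crat a.+2 (fun phi v =>
  F phi [:: nth 0%N (behead v) 0, nth 0%N v 0 & behead (behead v)]).
Proof.
move=> [x [y [d [/cnat_swap cx /cnat_swap cy /cnat_swap cd hF]]]].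
do 3!eexists; split; [exact: cx|exact: cy|exact: cd|].
by move=> phi v sv; rewrite hF //= !size_behead sv.
Qed.

Lemma crat_nat a N : cnat a N -> crat a (fun phi v => (N phi v)%:R).
Proof.
move=> cN; exists N, (fun _ _ => 0%N), (fun _ _ => 0%N).
by split=> // [||phi v _]; [exact: cnat_const|exact: cnat_const|rewrite subr0 divr1].
Qed.

Lemma crat_opp a F : crat a F -> crat a (fun phi v => - F phi v).
Proof.
move=> [x [y [d [cx cy cd hF]]]]; exists y, x, d; split=> // phi v sv.
by rewrite hF // -mulNr opprB.
Qed.

Lemma crat_divS a F N :
  crat a F -> cnat a N -> crat a (fun phi v => F phi v / (N phi v).+1%:R).
Proof.
move=> [x [y [d [cx cy cd hF]]]] cN.
exists x, y, (fun phi v => ((d phi v).+1 * (N phi v).+1).-1)%N; split=> //.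
  by apply/cnat_pred/cnat_mul; exact: cnat_S.
by move=> phi v sv; rewrite hF // prednK // natrM invfM mulrA.
Qed.

Lemma crat_add a F G :
  crat a F -> crat a G -> crat a (fun phi v => F phi v + G phi v).
Proof.
move=> [x [y [d [cx cy cd hF]]]] [x' [y' [d' [cx' cy' cd' hG]]]].
exists (fun phi v => x phi v * (d' phi v).+1 + x' phi v * (d phi v).+1)%N,
  (fun phi v => y phi v * (d' phi v).+1 + y' phi v * (d phi v).+1)%N,
  (fun phi v => ((d phi v).+1 * (d' phi v).+1).-1)%N; split.
- by apply: cnat_add; apply: cnat_mul => //; exact: cnat_S.
- by apply: cnat_add; apply: cnat_mul => //; exact: cnat_S.
- by apply/cnat_pred/cnat_mul; exact: cnat_S.
move=> phi v sv; rewrite hF // hG // prednK // !natrD !natrM.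
move: (natSr_neq0 (d phi v)) (natSr_neq0 (d' phi v)).
move: (_.+1%:R) (_.+1%:R) => D D' nzD nzD'.
by field; rewrite nzD nzD'.
Qed.

Lemma crat_mul a F G :
  crat a F -> crat a G -> crat a (fun phi v => F phi v * G phi v).
Proof.
move=> [x [y [d [cx cy cd hF]]]] [x' [y' [d' [cx' cy' cd' hG]]]].
exists (fun phi v => x phi v * x' phi v + y phi v * y' phi v)%N,
  (fun phi v => x phi v * y' phi v + y phi v * x' phi v)%N,
  (fun phi v => ((d phi v).+1 * (d' phi v).+1).-1)%N; split.
- by apply: cnat_add; exact: cnat_mul.
- by apply: cnat_add; exact: cnat_mul.
- by apply/cnat_pred/cnat_mul; exact: cnat_S.
move=> phi v sv; rewrite hF // hG // prednK // !natrD !natrM.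
move: (natSr_neq0 (d phi v)) (natSr_neq0 (d' phi v)).
move: (_.+1%:R) (_.+1%:R) => D D' nzD nzD'.
by field; rewrite nzD nzD'.
Qed.

Lemma natr_dist (x y : nat) :
  `|x%:R - y%:R| = ((x - y) + (y - x))%N%:R :> R.
Proof.
case: (leqP x y) => [xy|/ltnW yx].
  rewrite distrC -natrB // ger0_norm ?ler0n //.
  by move: xy; rewrite /leq => /eqP ->.
rewrite -natrB // ger0_norm ?ler0n //.
by move: yx; rewrite /leq => /eqP ->; rewrite addn0.
Qed.

Lemma crat_norm a F : crat a F -> crat a (fun phi v => `|F phi v|).
Proof.
move=> [x [y [d [cx cy cd hF]]]].
exists (fun phi v => (x phi v - y phi v) + (y phi v - x phi v))%N,
  (fun _ _ => 0%N), d; split=> //.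
- by apply: cnat_add; exact: cnat_sub.
- exact: cnat_const.
by move=> phi v sv; rewrite hF // normrM normfV normr_nat subr0 natr_dist.
Qed.

Lemma crat_if a b F G : cbool a b -> crat a F -> crat a G ->
  crat a (fun phi v => if b phi v then F phi v else G phi v).
Proof.
move=> cb [x [y [d [cx cy cd hF]]]] [x' [y' [d' [cx' cy' cd' hG]]]].
exists (fun phi v => if b phi v then x phi v else x' phi v),
  (fun phi v => if b phi v then y phi v else y' phi v),
  (fun phi v => if b phi v then d phi v else d' phi v).
split; try exact: cnat_if.
by move=> phi v sv; rewrite hF // hG //; case: (b phi v).
Qed.

Lemma cbool_ltr a F G :
  crat a F -> crat a G -> cbool a (fun phi v => F phi v < G phi v).
Proof.
move=> cF cG.
have [x [y [d [cx cy cd hF]]]] := crat_add cG (crat_opp cF).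
apply: cnat_ext (cbool_leq (cnat_S cy) cx) => phi v sv.
by rewrite -[F phi v < _]subr_gt0 hF // pmulr_lgt0 ?invr_gt0 ?ltr0n // subr_gt0
  ltr_nat.
Qed.

(** The terms are brought to the common denominator [Q], the product of all denominators, so that
    the quotients in [S] are exact. *)
Lemma crat_sum a N (G : (nat -> nat) -> seq nat -> nat -> R) :
  cnat a N -> crat a.+1 (fun phi v => G phi (behead v) (nth 0%N v 0)) ->
  crat a (fun phi v => \sum_(0 <= i < N phi v) G phi v i).
Proof.
move=> cN [x [y [d [cx cy cd hG]]]].
pose Q phi v := (\prod_(0 <= i < N phi v) (d phi (i :: v)).+1)%N.
pose S (z : (nat -> nat) -> seq nat -> nat) phi v :=
  (\sum_(0 <= i < N phi v) z phi (i :: v) * (Q phi v %/ (d phi (i :: v)).+1))%N.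
have cconsE z : cnat a.+1 z ->
    cnat a.+1 (fun phi v => z phi (nth 0%N v 0 :: behead v)).
  by apply: cnat_ext => phi [].
have cQ : cnat a Q.
  by apply: cnat_prod => //; exact/cnat_S/cconsE.
have cS z : cnat a.+1 z -> cnat a (S z).
  move=> cz; apply: cnat_sum => //; apply: cnat_mul; first exact: cconsE.
  by apply: cnat_div; [exact: cnat_behead|exact/cnat_S/cconsE].
exists (S x), (S y), (fun phi v => (Q phi v).-1); split.
- exact: cS.
- exact: cS.
- exact: cnat_pred.
move=> phi v sv; have Q_gt0 : (0 < Q phi v)%N by exact: prodn_gt0.
rewrite prednK // /S !natr_sum -sumrB mulr_suml.
apply: eq_big_nat => i /andP[_ iN].
have dQ : ((d phi (i :: v)).+1 %| Q phi v)%N.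
  rewrite /Q (bigD1_seq i) ?iota_uniq ?mem_index_iota //=.
  exact: dvdn_mulr.
rewrite !natrM natf_div // (hG phi (i :: v)) /= ?sv // -mulrBl.
have nzQ : (Q phi v)%:R != 0 :> R by rewrite pnatr_eq0 -lt0n.
by rewrite !mulrA [_ * _ / _ / _]mulrAC mulfK.
Qed.

(** Sign and absolute value are computed apart, from the parity of the number [s] of negative
    factors and from the product [M] of the absolute numerators. *)
Lemma crat_prod a N (G : (nat -> nat) -> seq nat -> nat -> R) :
  cnat a N -> crat a.+1 (fun phi v => G phi (behead v) (nth 0%N v 0)) ->
  crat a (fun phi v => \prod_(0 <= i < N phi v) G phi v i).
Proof.
move=> cN [x [y [d [cx cy cd hG]]]].
have cconsE z : cnat a.+1 z ->
    cnat a.+1 (fun phi v => z phi (nth 0%N v 0 :: behead v)).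
  by apply: cnat_ext => phi [].
pose s phi v := (\sum_(0 <= i < N phi v) (x phi (i :: v) < y phi (i :: v)))%N.
pose M phi v := (\prod_(0 <= i < N phi v)
  ((x phi (i :: v) - y phi (i :: v)) + (y phi (i :: v) - x phi (i :: v))))%N.
pose Q phi v := (\prod_(0 <= i < N phi v) (d phi (i :: v)).+1)%N.
have cs : cnat a s.
  apply: cnat_sum => //=.
  by apply: cbool_leq; [apply: cnat_S|]; exact: cconsE.
have cM : cnat a M.
  by apply: cnat_prod => //=; apply: cnat_add; apply: cnat_sub; exact: cconsE.
have cQ : cnat a Q by apply: cnat_prod => //; exact/cnat_S/cconsE.
exists (fun phi v => if odd (s phi v) then 0%N else M phi v),
  (fun phi v => if odd (s phi v) then M phi v else 0%N),
  (fun phi v => (Q phi v).-1); split.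
- by apply: cnat_if => //; [exact: cbool_odd|exact: cnat_const].
- by apply: cnat_if => //; [exact: cbool_odd|exact: cnat_const].
- exact: cnat_pred.
move=> phi v sv; have Q_gt0 : (0 < Q phi v)%N by exact: prodn_gt0.
rewrite prednK //; transitivity ((-1) ^+ s phi v * (M phi v)%:R / (Q phi v)%:R : R).
  rewrite /s /M /Q !natr_prod expr_sum -big_split /= -prodf_div.
  apply: eq_big_nat => i /andP[_ iN].
  rewrite (hG phi (i :: v)) /= ?sv // -natr_dist; congr (_ / _).
  rewrite -(ltr_nat R) -subr_lt0.
  case: (ltrP (_ - _) 0) => h; first by rewrite expr1 mulN1r ltr0_norm // opprK.
  by rewrite expr0 mul1r ger0_norm.
rewrite -signr_odd; case: (odd _); rewrite ?expr0 ?expr1 ?mulN1r ?mul1r ?sub0r ?subr0 //.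
Qed.

End RationalValued.

(** * Converging rational enclosures of real numbers *)

Section Balls.
Variable R : realType.
Implicit Types X Y : R -> seq nat -> R.

Lemma cvg_sum_nat N (u : nat -> nat -> R) (l : nat -> R) :
  (forall i, u i n @[n --> \oo] --> l i) ->
  \sum_(0 <= i < N) u i n @[n --> \oo] --> \sum_(0 <= i < N) l i.
Proof.
move=> ul; exact: (cvg_big (Ff := u) (Fa := l) (@add_continuous R)
  eventually_filter (fun i _ => ul i)).
Qed.

Lemma cvg_prod_nat N (u : nat -> nat -> R) (l : nat -> R) :
  (forall i, u i n @[n --> \oo] --> l i) ->
  \prod_(0 <= i < N) u i n @[n --> \oo] --> \prod_(0 <= i < N) l i.
Proof.
move=> ul; exact: (cvg_big (Ff := u) (Fa := l) (@mul_continuous R)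
  eventually_filter (fun i _ => ul i)).
Qed.

(** No rate of convergence is asked of the radius: a search for a certified strict inequality only
    needs it to tend to 0. *)
Definition enclosure (x : R) (c e : nat -> R) : Prop :=
  (forall n, `|c n - x| <= e n) /\ e @ \oo --> 0.

Lemma enclosure_cvg x c e : enclosure x c e -> c @ \oo --> x.
Proof.
move=> [ce e0]; apply/cvgrPdist_le => eps eps_gt0.
apply: filterS (cvgr_lt _ e0 _ eps_gt0) => n /ltW; apply: le_trans.
by rewrite distrC.
Qed.

Lemma enclosureD x c e y c' e' : enclosure x c e -> enclosure y c' e' ->
  enclosure (x + y) (fun n => c n + c' n) (fun n => e n + e' n).
Proof.
move=> [ce e0] [ce' e0']; split=> [n|].
  rewrite opprD addrACA (le_trans (ler_normD _ _)) //.
  by apply: lerD.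
by rewrite -(addr0 0); exact: cvgD.
Qed.

(** The radius must be computable from the approximations, so the unknown [|y|] is bounded by
    [|c'| + e']. *)
Lemma enclosureM x c e y c' e' : enclosure x c e -> enclosure y c' e' ->
  enclosure (x * y) (fun n => c n * c' n)
    (fun n => `|c n| * e' n + (`|c' n| + e' n) * e n).
Proof.
move=> cx cy; have cc := enclosure_cvg cx; have cc' := enclosure_cvg cy.
move: cx cy => [ce e0] [ce' e0']; split=> [n|].
  have -> : c n * c' n - x * y = c n * (c' n - y) + y * (c n - x) by ring.
  rewrite (le_trans (ler_normD _ _)) // !normrM lerD //.
    by rewrite ler_wpM2l.
  rewrite ler_pM //; move: (ce' n); rewrite distrC => h.
  by rewrite -[y](subrKC (c' n)) (le_trans (ler_normD _ _)) // lerD2l.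
have -> : (0 : R) = `|x| * 0 + (`|y| + 0) * 0 by ring.
by apply: cvgD; apply: cvgM => //; [exact: cvg_norm|
  apply: cvgD => //; exact: cvg_norm].
Qed.

Lemma enclosure_sum N (x : nat -> R) (c e : nat -> nat -> R) :
  (forall i, enclosure (x i) (c i) (e i)) ->
  enclosure (\sum_(0 <= i < N) x i) (fun n => \sum_(0 <= i < N) c i n)
    (fun n => \sum_(0 <= i < N) e i n).
Proof.
move=> cx; split=> [n|].
  rewrite -sumrB (le_trans (ler_norm_sum _ _ _)) // ler_sum // => i _.
  exact: (cx i).1.
by have := @cvg_sum_nat N e (fun=> 0) (fun i => (cx i).2); rewrite big1_eq.
Qed.

(** Splitting off the last factor as for a product of two reals, with [|x i| <= |c i| + e i], makes
    the bound satisfy the same recursion as the error. *)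
Lemma distr_prod_le N (x c e : nat -> R) :
  (forall i, `|c i - x i| <= e i) ->
  `|\prod_(0 <= i < N) c i - \prod_(0 <= i < N) x i| <=
  \prod_(0 <= i < N) (`|c i| + e i) - \prod_(0 <= i < N) `|c i|.
Proof.
move=> cx; elim: N => [|N IHN]; first by rewrite !big_geq // !subrr normr0.
rewrite !big_nat_recr //=.
move: IHN; rewrite -!normr_prod.
set c' := \prod_(0 <= i < N) c i; set x' := \prod_(0 <= i < N) x i.
set d := \prod_(0 <= i < N) _ => IHN.
have -> : c' * c N - x' * x N = c' * (c N - x N) + (c' - x') * x N by ring.
have -> : d * (`|c N| + e N) - `|c'| * `|c N| =
  `|c'| * e N + (d - `|c'|) * (`|c N| + e N) by ring.
rewrite (le_trans (ler_normD _ _)) // !normrM lerD //.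
  by rewrite ler_wpM2l.
rewrite ler_pM //; move: (cx N); rewrite distrC => h.
by rewrite -[x N](subrKC (c N)) (le_trans (ler_normD _ _)) // lerD2l.
Qed.

Lemma enclosure_prod N (x : nat -> R) (c e : nat -> nat -> R) :
  (forall i, enclosure (x i) (c i) (e i)) ->
  enclosure (\prod_(0 <= i < N) x i) (fun n => \prod_(0 <= i < N) c i n)
    (fun n => \prod_(0 <= i < N) (`|c i n| + e i n)
              - \prod_(0 <= i < N) `|c i n|).
Proof.
move=> cx; split=> [n|]; first by apply: distr_prod_le => i; exact: (cx i).1.
rewrite -(subrr (\prod_(0 <= i < N) `|x i|)); apply: cvgB.
  apply: (@cvg_prod_nat N (fun i n => `|c i n| + e i n) (fun i => `|x i|)) => i.
  rewrite -[`|x i|]addr0; apply: cvgD; last exact: (cx i).2.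
  exact: (cvg_norm (enclosure_cvg (cx i))).
apply: (@cvg_prod_nat N (fun i n => `|c i n|) (fun i => `|x i|)) => i.
exact: (cvg_norm (enclosure_cvg (cx i))).
Qed.

(* Uniform computability in (a name of) the exponent [p]: the first argument of
   the programs for [c] and [e] is the precision. *)
Definition cball (a : nat) (X : R -> seq nat -> R) : Prop :=
  exists c e, [/\ crat a.+1 c, crat a.+1 e & forall p phi v,
    1 <= p -> represents phi p -> size v = a ->
    enclosure (X p v) (fun n => c phi (n :: v)) (fun n => e phi (n :: v))].

Lemma cball_ext a X Y : (forall p v, size v = a -> X p v = Y p v) ->
  cball a X -> cball a Y.
Proof.
move=> XY [c [e [cc ce cX]]]; exists c, e; split=> // p phi v p1 hp sv.
by rewrite -XY //; exact: cX.
Qed.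

Lemma cball_crat a (F : seq nat -> R) :
  crat a (fun _ v => F v) -> cball a (fun _ v => F v).
Proof.
move=> cF; exists (fun _ v => F (behead v)), (fun _ _ => 0%:R); split.
- exact: (crat_behead cF).
- exact/crat_nat/cnat_const.
by move=> p phi v _ _ _ /=; split=> [n|]; [rewrite subrr normr0|exact: cvg_cst].
Qed.

Lemma cball_add a X Y :
  cball a X -> cball a Y -> cball a (fun p v => X p v + Y p v).
Proof.
move=> [c [e [cc ce cX]]] [c' [e' [cc' ce' cY]]].
exists (fun phi v => c phi v + c' phi v), (fun phi v => e phi v + e' phi v).
split; [exact: crat_add|exact: crat_add|move=> p phi v p1 hp sv].
by apply: enclosureD; [exact: cX|exact: cY].
Qed.

Lemma cball_mul a X Y :
  cball a X -> cball a Y -> cball a (fun p v => X p v * Y p v).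
Proof.
move=> [c [e [cc ce cX]]] [c' [e' [cc' ce' cY]]].
exists (fun phi v => c phi v * c' phi v), (fun phi v =>
  `|c phi v| * e' phi v + (`|c' phi v| + e' phi v) * e phi v).
split; first exact: crat_mul.
  apply: crat_add; apply: crat_mul => //; first exact: crat_norm.
  by apply: crat_add => //; exact: crat_norm.
by move=> p phi v p1 hp sv; apply: enclosureM; [exact: cX|exact: cY].
Qed.

Lemma cball_sum a N (X : R -> seq nat -> nat -> R) :
  cnat a (fun _ v => N v) ->
  cball a.+1 (fun p v => X p (behead v) (nth 0%N v 0)) ->
  cball a (fun p v => \sum_(0 <= i < N v) X p v i).
Proof.
move=> cN [c [e [/crat_swap cc /crat_swap ce cX]]].
exists (fun phi v => \sum_(0 <= i < N (behead v))
          c phi [:: nth 0%N v 0, i & behead v]),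
  (fun phi v => \sum_(0 <= i < N (behead v))
          e phi [:: nth 0%N v 0, i & behead v]).
split; [| |move=> p phi v p1 hp sv].
- by apply: crat_sum => //; exact: (cnat_behead cN).
- by apply: crat_sum => //; exact: (cnat_behead cN).
by apply: enclosure_sum => i; apply: (cX p phi (i :: v)); rewrite //= sv.
Qed.

Lemma cball_prod a N (X : R -> seq nat -> nat -> R) :
  cnat a (fun _ v => N v) ->
  cball a.+1 (fun p v => X p (behead v) (nth 0%N v 0)) ->
  cball a (fun p v => \prod_(0 <= i < N v) X p v i).
Proof.
move=> cN [c [e [/crat_swap cc /crat_swap ce cX]]].
exists (fun phi v => \prod_(0 <= i < N (behead v))
          c phi [:: nth 0%N v 0, i & behead v]),
  (fun phi v =>
     \prod_(0 <= i < N (behead v)) (`|c phi [:: nth 0%N v 0, i & behead v]|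
        + e phi [:: nth 0%N v 0, i & behead v])
     - \prod_(0 <= i < N (behead v)) `|c phi [:: nth 0%N v 0, i & behead v]|).
have cN' := cnat_behead cN.
split; [| |move=> p phi v p1 hp sv].
- exact: crat_prod.
- apply: crat_add; last (apply: crat_opp; apply: crat_prod => //).
    by apply: crat_prod => //; apply: crat_add => //; exact: crat_norm.
  exact: crat_norm.
by apply: enclosure_prod => i; apply: (cX p phi (i :: v)); rewrite //= sv.
Qed.

(** The test asks that the first enclosure end before the second begins. It is sound at every
    precision; if the inequality holds, the midpoint eventually separates the two enclosures. *)
Lemma cball_lt a X Y : cball a X -> cball a Y -> exists2 b, cbool a.+1 b &
  forall p phi v, 1 <= p -> represents phi p -> size v = a ->
    (forall n, b phi (n :: v) -> X p v < Y p v) /\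
    (X p v < Y p v -> exists N, forall n, (N <= n)%N -> b phi (n :: v)).
Proof.
move=> [c [e [cc ce cX]]] [c' [e' [cc' ce' cY]]].
exists (fun phi v => c phi v + e phi v < c' phi v - e' phi v).
  by apply: cbool_ltr; apply: crat_add => //; exact: crat_opp.
move=> p phi v p1 hp sv; have EX := cX p phi v p1 hp sv.
have EY := cY p phi v p1 hp sv; split=> [n|XY].
  have := EX.1 n; have := EY.1 n; rewrite !ler_norml; lra.
have cvgX : c phi (n :: v) + e phi (n :: v) @[n --> \oo] --> X p v + 0.
  by apply: cvgD; [exact: enclosure_cvg EX|exact: EX.2].
have cvgY : c' phi (n :: v) - e' phi (n :: v) @[n --> \oo] --> Y p v - 0.
  by apply: cvgB; [exact: enclosure_cvg EY|exact: EY.2].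
rewrite addr0 in cvgX; rewrite subr0 in cvgY.
pose m := (X p v + Y p v) / 2.
have Xm : X p v < m by rewrite /m; lra.
have mY : m < Y p v by rewrite /m; lra.
have [N _ hN] := filterI (cvgr_lt _ cvgX m Xm) (cvgr_gt _ cvgY m mY).
by exists N => n /hN[h h']; exact: lt_trans h h'.
Qed.

End Balls.

(** * Enclosing powers with a real exponent *)

Section Power.
Variable R : realType.

(* The integer part of [2 ^ n * (x / y) `^ (c / 2 ^ n)], found by comparing
   integer powers only. *)
Definition floor_pow (x y c n : nat) : nat :=
  (\sum_(0 <= i < 2 ^ n * x.+1 ^ c)
     (i.+1 ^ (2 ^ n) * y ^ c <= x ^ c * (2 ^ n) ^ (2 ^ n)))%N.

Lemma floor_powE (x y c n : nat) : (0 < y)%N ->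
  floor_pow x y c n =
  Num.truncn (2 ^+ n * (x%:R / y%:R : R) `^ (c%:R / 2 ^+ n)).
Proof.
move=> y_gt0; set b : R := x%:R / y%:R; set beta := b `^ _.
have b_ge0 : 0 <= b by rewrite divr_ge0.
have beta_ge0 : 0 <= beta by exact: powR_ge0.
have e_gt0 : 0 < 2 ^+ n :> R by rewrite exprn_gt0.
have betaX : beta ^+ (2 ^ n) = b ^+ c.
  rewrite -powR_mulrn // -powRrM -powR_mulrn // natrX divfK //.
  by rewrite gt_eqF.
rewrite /floor_pow (eq_bigr (fun i =>
  (i < Num.truncn (2 ^+ n * beta))%N : nat)); last first.
  move=> i _; rewrite truncn_gt_nat; congr nat_of_bool.
  rewrite mulrC -ler_pdivrMr // -(@ler_pXn2r _ (2 ^ n)) ?expn_gt0 ?nnegrE //; last first.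
    by rewrite divr_ge0 // ltW.
  rewrite betaX !expr_div_n ler_pdivrMr; last by rewrite !exprn_gt0.
  rewrite mulrAC ler_pdivlMr ?exprn_gt0 ?ltr0n //.
  by rewrite -(ler_nat R) !natrM !natrX.
apply: sum_nat_lt.
(* The range of summation is long enough: [x + 1] dominates [x / y], and being at least 1 it only
   grows when raised to the power [2 ^ n]. *)
have le_beta : beta <= (x.+1 ^ c)%N%:R.
  rewrite -(@ler_pXn2r _ (2 ^ n)) ?expn_gt0 ?nnegrE ?ler0n // betaX.
  apply: (@le_trans _ _ ((x.+1 ^ c)%N%:R)).
    rewrite natrX; apply: lerXn2r; rewrite ?nnegrE //.
    rewrite /b ler_pdivrMr ?ltr0n // -natrM ler_nat.
    by rewrite (leq_trans (leqnSn _)) // leq_pmulr.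
  by rewrite -natrX ler_nat -{1}[X in (X <= _)%N]expn1 leq_pexp2l ?expn_gt0.
rewrite -(ler_nat R) (le_trans (y := 2 ^+ n * beta)) //.
  by rewrite truncn_le // mulr_ge0 // ltW.
by rewrite natrM natrX ler_wpM2l // ltW.
Qed.

Lemma floor_pow_bounds (x y c n : nat) : (0 < y)%N ->
  (floor_pow x y c n)%:R / 2 ^+ n <= (x%:R / y%:R : R) `^ (c%:R / 2 ^+ n)
    <= ((floor_pow x y c n)%:R + 1) / 2 ^+ n.
Proof.
move=> y_gt0; have e_gt0 : 0 < 2 ^+ n :> R by rewrite exprn_gt0.
rewrite ler_pdivrMr // ler_pdivlMr // floor_powE //; set z := _ `^ _.
have z_ge0 : 0 <= z by exact: powR_ge0.
rewrite [z * _]mulrC; have /truncn_itv/andP[-> /ltW] : 0 <= 2 ^+ n * z.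
  by rewrite mulr_ge0 // ltW.
by rewrite natr1.
Qed.

Lemma cnat_floor_pow a x y c n : cnat a x -> cnat a y -> cnat a c -> cnat a n ->
  cnat a (fun phi v => floor_pow (x phi v) (y phi v) (c phi v) (n phi v)).
Proof.
move=> cx cy cc cn; apply: cnat_sum => [|/=].
  apply: cnat_mul; first by apply: cnat_exp => //; exact: cnat_const.
  by apply: cnat_exp => //; exact: cnat_S.
have [cx' cy' cc' cn'] := And4 (cnat_behead cx) (cnat_behead cy)
  (cnat_behead cc) (cnat_behead cn).
have c2n : cnat a.+1 (fun phi v => 2 ^ n phi (behead v))%N.
  by apply: cnat_exp => //; exact: cnat_const.
apply: cbool_leq; apply: cnat_mul; apply: cnat_exp => //.
- exact/cnat_S/cnat_nth.
Qed.

(** The power is monotone in its exponent, in a direction that depends on whether [b] exceeds 1. For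
    [b = 0] the upper exponent is positive and gives 0, whereas [q = 0] would give 1. *)
Lemma powR_between (b q r s : R) : 0 <= b -> 0 <= q -> q <= r <= s -> 0 < r ->
  Num.min (b `^ q) (b `^ s) <= b `^ r <= Num.max (b `^ q) (b `^ s).
Proof.
move=> b_ge0 q_ge0 /andP[qr rs] r_gt0; rewrite ge_min le_max.
have [->|b_neq0] := eqVneq b 0.
  have s_gt0 := lt_le_trans r_gt0 rs.
  by rewrite (powR0 (lt0r_neq0 r_gt0)) (powR0 (lt0r_neq0 s_gt0)) lexx !orbT.
have b_gt0 : 0 < b by rewrite lt_def b_neq0.
have [b1|/ltW b1] := lerP b 1.
  have b01 : 0 < b <= 1 by rewrite b_gt0.
  by rewrite (ger_powR b01 rs) (ger_powR b01 qr) !orbT.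
by rewrite (ler_powR b1 qr) (ler_powR b1 rs) !orbT.
Qed.

Lemma powR_cvg_exponent (b p : R) (q : nat -> R) : 0 <= b -> 0 < p ->
  q @ \oo --> p -> b `^ q n @[n --> \oo] --> b `^ p.
Proof.
move=> b_ge0 p_gt0 qp; have [->|b_neq0] := eqVneq b 0.
  rewrite powR0 ?gt_eqF //; apply: cvg_near_cst.
  apply: filterS (cvgr_gt _ qp 0 p_gt0) => n q_gt0.
  by rewrite powR0 ?gt_eqF.
rewrite /powR (negbTE b_neq0).
have cvg_ln : q n * ln b @[n --> \oo] --> p * ln b.
  by apply: cvgM => //; exact: cvg_cst.
exact: (cvg_comp _ _ cvg_ln (@continuous_expR R _)).
Qed.

Lemma cvg_pow2V : (2 ^- n : R) @[n --> \oo] --> 0.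
Proof.
rewrite (_ : (fun n => _) = (fun n => 2^-1 ^+ n)); last first.
  by apply/funext => n; rewrite exprVn.
by apply: cvg_expr; rewrite ger0_norm ?invr_ge0 // invf_lt1 // ltr1n.
Qed.

(** A negative numerator would be at distance more than [p >= 1 >= 2 ^- n] from [p]; hence the code
    is even and its half is the numerator. *)
Lemma represents_half (phi : nat -> nat) (p : R) n : 1 <= p -> represents phi p ->
  `|((phi n)./2)%:R / 2 ^+ n - p| <= 2 ^- n.
Proof.
move=> p1 /(_ n); rewrite /int_of_code; case: (odd _) => //.
have e_gt0 : 0 < 2 ^+ n :> R by rewrite exprn_gt0.
rewrite ler_norml NegzE; set m := (phi n)./2.
rewrite mulrNz mulNr => /andP[h _].
have h' : m.+1%:R / 2 ^+ n <= 2 ^- n - p by lra.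
have := le_trans h' (lerB (lexx _) p1); rewrite ler_pdivrMr // mulrBl.
rewrite mulVf ?gt_eqF // mul1r lerBrDl -natr1 => h1.
have m_ge0 : 0 <= m%:R :> R by [].
lra.
Qed.

(** The exponent lies between [lo] and [hi], one grid step on either side of its approximation. The
    rounded power at [lo] is the centre; the radius is its distance to the rounded power at [hi],
    plus [2 ^- n] for the rounding. *)
Lemma cball_powR a (F : seq nat -> R) :
  (forall v, size v = a -> 0 <= F v) -> crat a (fun _ v => F v) ->
  cball a (fun p v => F v `^ p).
Proof.
move=> F_ge0 [x [y [d [cx cy cd hF]]]].
pose f (c : nat -> nat) phi v := floor_pow (x phi (behead v) - y phi (behead v))
  (d phi (behead v)).+1 (c (phi (nth 0%N v 0))./2) (nth 0%N v 0).
pose D (v : seq nat) := (2 ^ nth 0%N v 0).-1.+1%:R : R.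
have cc : cnat a.+1 (fun phi v => (phi (nth 0%N v 0))./2).
  exact/cnat_half/cnat_oracle/cnat_nth.
have cf c : cnat a.+1 (fun phi v => c (phi (nth 0%N v 0))./2) -> cnat a.+1 (f c).
  move=> cfc; apply: cnat_floor_pow => //; last exact: cnat_nth.
    by apply: cnat_sub; exact: cnat_behead.
  by apply: cnat_S; exact: cnat_behead.
have cD : cnat a.+1 (fun _ v => (2 ^ nth 0%N v 0).-1)%N.
  by apply/cnat_pred/cnat_exp; [exact: cnat_const|exact: cnat_nth].
exists (fun phi v => (f predn phi v)%:R / D v),
  (fun phi v => (`|(f predn phi v)%:R - (f succn phi v)%:R| + 1%:R) / D v).
have c1 := crat_nat R (cf predn (cnat_pred cc)).
have c2 := crat_nat R (cf succn (cnat_S cc)).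
split; first exact: crat_divS.
  apply: crat_divS => //; apply: crat_add; last exact/crat_nat/cnat_const.
  by apply: crat_norm; apply: crat_add => //; exact: crat_opp.
move=> p phi v p1 hp sv.
have p_gt0 : 0 < p by lra.
have hD n : D (n :: v) = 2 ^+ n by rewrite /D /= prednK ?expn_gt0 // natrX.
set b := F v; have b_ge0 : 0 <= b by exact: F_ge0.
have hb : b = (x phi v - y phi v)%N%:R / (d phi v).+1%:R.
  have := hF phi v sv; rewrite -/b => bE; rewrite bE natrB //.
  rewrite -(ler_nat R) -subr_ge0; move: b_ge0; rewrite bE.
  by rewrite pmulr_lge0 // invr_gt0 ltr0n.
have fE c n : (f c phi (n :: v))%:R / D (n :: v) <= b `^ ((c (phi n)./2)%:R / 2 ^+ n)
    <= ((f c phi (n :: v))%:R + 1) / D (n :: v).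
  by rewrite hD hb; exact: floor_pow_bounds.
pose lo n := (phi n)./2.-1%:R / 2 ^+ n : R.
pose hi n := (phi n)./2.+1%:R / 2 ^+ n : R.
have e_gt0 n : 0 < 2 ^- n :> R by rewrite invr_gt0 exprn_gt0.
have plo n : p - 2 * 2 ^- n <= lo n <= p.
  have := represents_half n p1 hp; rewrite /lo ler_norml; have := e_gt0 n.
  case: (phi n)./2 => [|m] /=; rewrite ?mul0r; first by move=> *; lra.
  by rewrite -natr1 mulrDl mul1r => *; lra.
have phi_ n : p <= hi n <= p + 2 * 2 ^- n.
  have := represents_half n p1 hp; rewrite /hi ler_norml; have := e_gt0 n.
  by rewrite -natr1 mulrDl mul1r => *; lra.
have cvg2 : (2 * 2 ^- n : R) @[n --> \oo] --> 0.
  by rewrite -(mulr0 2); apply: cvgM; [exact: cvg_cst|exact: cvg_pow2V].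
have cvg_lo : lo @ \oo --> p.
  apply: (squeeze_cvgr (f := fun n => p - 2 * 2 ^- n) (h := fun=> p)).
  - exact: nearW.
  - by rewrite -[X in _ --> X]subr0; apply: cvgB => //; exact: cvg_cst.
  exact: cvg_cst.
have cvg_hi : hi @ \oo --> p.
  apply: (squeeze_cvgr (f := fun=> p) (h := fun n => p + 2 * 2 ^- n)).
  - exact: nearW.
  - exact: cvg_cst.
  by rewrite -[X in _ --> X]addr0; apply: cvgD => //; exact: cvg_cst.
have cvg_f c : b `^ ((c (phi n)./2)%:R / 2 ^+ n) @[n --> \oo] --> b `^ p ->
    (f c phi (n :: v))%:R / D (n :: v) @[n --> \oo] --> b `^ p.
  move=> cvgc; apply: (squeeze_cvgr
    (f := fun n => b `^ ((c (phi n)./2)%:R / 2 ^+ n) - 2 ^- n)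
    (h := fun n => b `^ ((c (phi n)./2)%:R / 2 ^+ n))) => //.
    apply: nearW => n; have := fE c n; rewrite hD mulrDl mul1r => *; lra.
  by rewrite -[X in _ --> X]subr0; apply: cvgB => //; exact: cvg_pow2V.
have cvg1 := cvg_f predn (powR_cvg_exponent b_ge0 p_gt0 cvg_lo).
have cvg2' := cvg_f succn (powR_cvg_exponent b_ge0 p_gt0 cvg_hi).
split=> [n|].
  have lo_ge0 : 0 <= lo n by rewrite mulr_ge0 // ltW.
  have /andP[plo1 plo2] := plo n; have /andP[phi1 phi2] := phi_ n.
  have ple : lo n <= p <= hi n by rewrite plo2.
  have := powR_between b_ge0 lo_ge0 ple p_gt0.
  have := fE predn n; have := fE succn n; rewrite -/(lo n) -/(hi n).
  have D_gt0 : 0 < (D (n :: v))^-1 by rewrite hD; exact: e_gt0.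
  rewrite !mulrDl !mul1r; set l := f predn _ _; set u := f succn _ _.
  have -> : `|l%:R - u%:R| / D (n :: v) = `|l%:R / D (n :: v) - u%:R / D (n :: v)|.
    by rewrite -mulrBl normrM (gtr0_norm D_gt0).
  move: D_gt0; move: (l%:R / D _) (u%:R / D _) => A B; move: (D _)^-1 => e.
  move: (b `^ lo n) (b `^ hi n) (b `^ p) => P Q z e0 hB hA.
  rewrite ge_min le_max ler_norml => /andP[/orP[] h1 /orP[] h2];
    case: (lerP A B) => AB; rewrite ?(ler0_norm (x := A - B)) ?(gtr0_norm (x := A - B));
    lra.
have -> : (fun n => (`|(f predn phi (n :: v))%:R - (f succn phi (n :: v))%:R| + 1)
    / D (n :: v)) = (fun n => `|(f predn phi (n :: v))%:R / D (n :: v)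
     - (f succn phi (n :: v))%:R / D (n :: v)| + 2 ^- n).
  apply/funext => n; rewrite hD mulrDl mul1r -mulrBl normrM.
  by rewrite (gtr0_norm (e_gt0 n)).
have -> : (0 : R) = `|b `^ p - b `^ p| + 0 by rewrite subrr normr0 addr0.
apply: cvgD; last exact: cvg_pow2V.
by apply: cvg_norm; apply: cvgB.
Qed.

End Power.

(** * Characters of the cube *)

Definition bit (i j : nat) : bool := odd (i %/ 2 ^ j).

(** Binary digits link the row numbers below [2 ^ k], which programs handle, to the points of the
    cube, which the proofs handle. *)
Definition bits (k i : nat) : {ffun 'I_k -> bool} := [ffun j => bit i (val j)].

Lemma bits_inj k i i' :
  (i < 2 ^ k)%N -> (i' < 2 ^ k)%N -> bits k i = bits k i' -> i = i'.
Proof.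
elim: k i i' => [|k IHk] i i'; first by rewrite !ltnS !leqn0 => /eqP-> /eqP->.
rewrite expnS => lt_i lt_i' eq_b.
have bitE j : (j < k.+1)%N -> bit i j = bit i' j.
  by move=> jk; have /ffunP/(_ (Ordinal jk)) := eq_b; rewrite !ffunE.
have eq_odd : odd i = odd i' by have := bitE 0%N isT; rewrite /bit !divn1.
rewrite -[i]odd_double_half -[i']odd_double_half eq_odd; congr (_ + _.*2)%N.
apply: IHk; rewrite -?divn2 ?ltn_divLR ?[(2 ^ k * 2)%N]mulnC //.
apply/ffunP => j; rewrite !ffunE /bit -!divnMA -expnS.
exact: (bitE (val j).+1 (ltn_ord j)).
Qed.

Lemma sum_bits (V : zmodType) k (F : {ffun 'I_k -> bool} -> V) :
  \sum_(0 <= i < 2 ^ k) F (bits k i) = \sum_u F u.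
Proof.
rewrite big_mkord; symmetry.
rewrite (reindex (fun i : 'I_(2 ^ k) => bits k i)) //=.
apply: onW_bij; apply: inj_card_bij => [i i'|].
  by move=> /bits_inj E; apply: val_inj; apply: E.
by rewrite card_ffun card_bool !card_ord.
Qed.

Section Characters.
Variables (R : realType) (k : nat).
Implicit Types S u w y : {ffun 'I_k -> bool}.

Definition weight u : nat := (\sum_j u j)%N.
Definition xor u y : {ffun 'I_k -> bool} := [ffun j => u j (+) y j].
Definition character S w : R := \prod_j (-1) ^+ (S j && w j).

Lemma xorK y : involutive (xor^~ y).
Proof. by move=> u; apply/ffunP => j; rewrite !ffunE addbK. Qed.

Lemma character_xor S u y : character S (xor u y) = character S u * character S y.
Proof.
rewrite -big_split; apply: eq_bigr => j _ /=; rewrite ffunE.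
by case: (S j) (u j) (y j) => [] [] []; rewrite /= ?expr0 ?expr1 ?mulN1r ?opprK ?mul1r ?mulr1.
Qed.

Lemma characterC S w : character S w = character w S.
Proof. by apply: eq_bigr => j _; rewrite andbC. Qed.

Lemma character0l w : character [ffun=> false] w = 1.
Proof. by apply: big1 => j _; rewrite ffunE. Qed.

(** Translating the summation variable by [y] pulls out the factor [character S y]: characters are
    eigenvectors of the convolution. *)
Lemma sum_character_xor S y (f : nat -> R) :
  \sum_u character S u * f (weight (xor u y)) =
  character S y * \sum_u character S u * f (weight u).
Proof.
rewrite (reindex_inj (inv_inj (xorK y))) mulr_sumr; apply: eq_bigr => u _ /=.
by rewrite xorK character_xor mulrAC mulrA [character S y * _]mulrC mulrAC.
Qed.

(** The sum factors over the coordinates into terms [1 + (-1) ^ (y j)], each equal to 2 or 0. *)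
Lemma sum_character y :
  \sum_S character S y = if y == [ffun=> false] then 2 ^+ k else 0.
Proof.
rewrite -(bigA_distr_bigA (fun j (b : bool) => (-1) ^+ (b && y j) : R)) /=.
case: eqP => [->|y_neq0].
  rewrite (eq_bigr (fun=> 2)) ?prodr_const ?card_ord // => j _.
  by rewrite big_bool /= ffunE !expr0.
have [j yj] : exists j, y j.
  apply/existsP; rewrite -[X in is_true X]negbK negb_exists; apply/negP => /forallP h.
  by apply: y_neq0; apply/ffunP => j; rewrite ffunE; apply/negbTE/h.
rewrite (bigD1 j) //= big_bool /= yj expr0 expr1 addNr mul0r //.
Qed.

End Characters.

(** * Nonvanishing for small offsets *)

Section Nonvanishing.
Variable R : realType.

Lemma near_right0P (P : R -> Prop) : (\forall h \near 0^'+, P h) <->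
  exists2 d : R, 0 < d & forall h, 0 < h < d -> P h.
Proof.
split=> [/nbhs_ballP[d /= d_gt0 hd]|[d d_gt0 hd]].
  exists d => // h /andP[h_gt0 hd']; apply: hd => //=.
  by rewrite /ball /= sub0r normrN gtr0_norm.
near=> h; apply: hd; apply/andP; split; near: h.
  exact: nbhs_right_gt.
exact: nbhs_right_lt.
Unshelve. all: by end_near. Qed.

(** If [f] has a zero [z] close to 0, a second zero in [(0, z)] would by Rolle's theorem give a zero
    of [df] between them; so [f] has no zero in [(0, z)]. *)
Lemma near_right0_neq0_derive (f df : R -> R) :
  (\forall h \near (0 : R)^'+, is_derive (h : R) (1 : R) f (df h)) ->
  (\forall h \near 0^'+, df h != 0) -> \forall h \near 0^'+, f h != 0.
Proof.
move=> /near_right0P[d d_gt0 fd] /near_right0P[d' d'_gt0 fd'].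
apply/near_right0P.
have [[z /andP[/andP[z_gt0]]]|] :=
  pselect (exists z, (0 < z < Num.min d d') && (f z == 0)); last first.
  move=> no_zero; exists (Num.min d d'); first by rewrite lt_min d_gt0.
  by move=> h hh; apply/negP => fh; apply: no_zero; exists h; rewrite hh.
rewrite lt_min => /andP[zd zd'] /eqP fz; exists z => // h /andP[h_gt0 hz].
apply/eqP => fh.
have fder x : x \in `[h, z] -> is_derive x (1 : R) f (df x).
  by rewrite in_itv /= => /andP[hx xz]; apply: fd; apply/andP; split; lra.
have [||||c] := @Rolle R f h z.
- exact: hz.
- move=> x xhz; have /fder[] // : x \in `[h, z].
  by move: xhz; rewrite !in_itv /= => /andP[/ltW-> /ltW->].
- by apply: derivable_within_continuous => x /fder[].
- by rewrite fz.
rewrite in_itv /= => /andP[hc cz] [_ fc].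
have [_] : is_derive c (1 : R) f (df c) by apply: fder; rewrite in_itv /= !ltW.
rewrite fc => dfc; have := fd' c; rewrite -dfc eqxx.
by move=> /(_ _)/negP; apply => //; apply/andP; split; lra.
Qed.

Lemma is_derive_bigsum (I : Type) (r : seq I) (f : I -> R -> R) (df : I -> R) (x : R) :
  (forall i, is_derive x (1 : R) (f i) (df i)) ->
  is_derive x (1 : R) (fun z => \sum_(i <- r) f i z) (\sum_(i <- r) df i).
Proof.
move=> fd; elim: r => [|i r IHr].
  rewrite big_nil (_ : (fun z => _) = cst 0); first exact: is_derive_cst.
  by apply/funext => z; rewrite big_nil.
rewrite big_cons (_ : (fun z => _) = f i + (fun z => \sum_(i <- r) f i z)).
  exact: is_deriveD.
by apply/funext => z; rewrite big_cons.
Qed.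

Lemma is_derive_subl (a x : R) : is_derive x (1 : R) (fun z => a - z) (-1).
Proof.
rewrite -[-1]add0r; apply: (is_deriveB (is_derive_cst a x 1) (is_derive_id x 1)).
Qed.

Lemma is_derive_powR_subl (a q x : R) : x < a ->
  is_derive x (1 : R) (fun z => (a - z) `^ q) (- (q * (a - x) `^ (q - 1))).
Proof.
move=> xa; have ax_gt0 : 0 < a - x by rewrite subr_gt0.
have := @is_derive1_comp R (@powR R ^~ q) (fun z => a - z) x _ _
  (is_derive1_powR q ax_gt0) (is_derive_subl a x).
by rewrite mulrN1.
Qed.

Section RealPowers.
Variables (I : finType) (a : I -> R).
Hypothesis a_ge2 : forall i, 2 <= a i.

(** The shape of an eigenvalue as a function of the offset: a singular term and a part smooth near
    0. Up to a factor, differentiation only lowers [q] by one and negates [b] and keeps [c]. *)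
Definition pow_sum (q c : R) (b : I -> R) (h : R) : R :=
  c * h `^ q + \sum_i b i * (a i - h) `^ q.

Lemma is_derive_pow_sum q c b (h : R) : 0 < h < 2 ->
  is_derive h (1 : R) (pow_sum q c b) (q * pow_sum (q - 1) c (fun i => - b i) h).
Proof.
move=> /andP[h_gt0 h_lt2].
have dh : is_derive h (1 : R) (fun z => c * z `^ q) (c * (q * h `^ (q - 1))).
  exact: (is_deriveZ c (is_derive1_powR q h_gt0)).
have ds : is_derive h (1 : R) (fun z => \sum_i b i * (a i - z) `^ q)
    (\sum_i b i * (- (q * (a i - h) `^ (q - 1)))).
  apply: is_derive_bigsum => i.
  apply: (is_deriveZ (b i) (@is_derive_powR_subl (a i) q h _)).
  by rewrite (lt_le_trans h_lt2).
apply: is_derive_eq (is_deriveD dh ds) _.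
rewrite /pow_sum mulrDr mulr_sumr mulrCA; congr (_ + _).
by apply: eq_bigr => i _; ring.
Qed.

(** The singular term blows up at 0, while [a i - h >= 1] and [q < 0] bound the rest by [K]. *)
Lemma near_pow_sum_neg q c b : c != 0 -> q < 0 ->
  \forall h \near 0^'+, pow_sum q c b h != 0.
Proof.
move=> c_neq0 q_lt0; set K := \sum_i `|b i|.
have K_ge0 : 0 <= K by apply: sumr_ge0.
have Kc_gt0 : 0 < `|c| / (K + 1) by rewrite divr_gt0 ?normr_gt0 //; lra.
have cvgq : h `^ (- q) @[h --> 0^'+] --> (0 : R) by apply: powR_cvg0; lra.
near=> h.
have h_gt0 : 0 < h by near: h; exact: nbhs_right_gt.
have h_lt1 : h < 1 by near: h; exact: nbhs_right_lt.
have : h `^ (- q) < `|c| / (K + 1) by near: h; exact: (cvgr_lt _ cvgq).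
rewrite powRN -[X in _ < X]invrK ltf_pV2 ?posrE ?powR_gt0 ?invr_gt0 //.
rewrite invf_div ltr_pdivrMr ?normr_gt0 // => hq.
have le_sum : `|\sum_i b i * (a i - h) `^ q| <= K.
  rewrite (le_trans (ler_norm_sum _ _ _)) // ler_sum // => i _.
  rewrite normrM ler_piMr // ger0_norm ?powR_ge0 // -[X in _ <= X](powRr0 (a i - h)).
  by rewrite ler_powR ?ltW //; have := a_ge2 i; lra.
rewrite /pow_sum addr_eq0; apply/eqP => E.
move: le_sum; rewrite -normrN -E normrM (ger0_norm (powR_ge0 _ _)) mulrC.
by move=> h'; lra.
Unshelve. all: by end_near. Qed.

(* Each differentiation lowers [q] by one, until the sum blows up at [0] or is
   constant. *)
Lemma near_pow_sum n q c b : c != 0 -> q < n%:R ->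
  (forall m : nat, q = m%:R -> c + (-1) ^+ m * \sum_i b i != 0) ->
  \forall h \near 0^'+, pow_sum q c b h != 0.
Proof.
move=> c_neq0; elim: n q b => [|n IHn] q b qn nz; first exact: near_pow_sum_neg.
have [q_lt0|q_gt0|q0] := ltgtP q 0; first exact: near_pow_sum_neg.
  apply: near_right0_neq0_derive.
    apply/near_right0P; exists 2 => // h hh; exact: is_derive_pow_sum.
  have := IHn (q - 1) (fun i => - b i).
  rewrite ltrBlDr natr1 => /(_ qn); move=> IH; apply: filterS (IH _) => [h nzh|m qm].
    by rewrite mulf_neq0 // gt_eqF.
  (* The condition is inherited: lowering the exponent by one and negating [b] leaves the signed sum
     unchanged. *)
  have := nz m.+1; rewrite -natr1 -qm subrK => /(_ erefl).
  by rewrite sumrN exprS mulN1r mulrN mulNr.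
apply: nearW => h; rewrite /pow_sum q0 powRr0 mulr1.
have -> : \sum_i b i * (a i - h) `^ 0 = \sum_i b i.
  by apply: eq_bigr => i _; rewrite powRr0 mulr1.
by have := nz 0%N q0; rewrite expr0 mul1r.
Qed.

End RealPowers.

(** Differentiating [m - n] times gives a nonzero multiple of the sum with exponent [n], which is
    nonzero near 0 by continuity; Rolle's theorem carries this back up to [m]. *)
Lemma near_moment_sum (I : finType) (a b : I -> R) (m n : nat) : (n <= m)%N ->
  \sum_i b i * a i ^+ n != 0 ->
  \forall h \near 0^'+, \sum_i b i * (a i - h) ^+ m != 0.
Proof.
have der l (h : R) : is_derive h (1 : R) (fun z => \sum_i b i * (a i - z) ^+ l)
    (- l%:R * \sum_i b i * (a i - h) ^+ l.-1).
  rewrite mulr_sumr; apply: is_derive_bigsum => i.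
  have dX : is_derive h (1 : R) (fun z => (a i - z) ^+ l)
      (l%:R * (a i - h) ^+ l.-1 * -1).
    rewrite (_ : (fun z => _) = (fun z => a i - z) ^+ l).
      exact: (is_deriveX l (is_derive_subl (a i) h)).
    by apply/funext => z; rewrite fctE.
  by apply: is_derive_eq (is_deriveZ (b i) dX) _; rewrite /GRing.scale /=; ring.
move=> nm nz; elim: m nm => [|m IHm].
  rewrite leqn0 => /eqP n0; apply: nearW => h; rewrite n0 in nz.
  by rewrite (eq_bigr (fun i => b i * a i ^+ 0)).
rewrite leq_eqVlt => /orP[/eqP nE|/IHm h]; last first.
  apply: near_right0_neq0_derive; first by apply: nearW => z; exact: der.
  by apply: filterS h => z /= ?; rewrite mulf_neq0 // oppr_eq0 pnatr_eq0.
have cont : {for 0, continuous (fun z => \sum_i b i * (a i - z) ^+ m.+1)}.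
  apply: differentiable_continuous; apply/derivable1_diffP.
  by have [] := der m.+1 0.
apply: cvg_within; apply: (cvgr_neq0 _ cont).
by rewrite -nE; under eq_bigr do rewrite subr0.
Qed.

End Nonvanishing.

(** * Eigenvalues of the convolution, and the necessity of the condition *)

Section Eigenvalues.
Variables (R : realType) (k : nat).
Implicit Types S u w y : {ffun 'I_k -> bool}.
Local Notation zero := ([ffun=> false] : {ffun 'I_k -> bool}).
Local Notation ones := ([ffun=> true] : {ffun 'I_k -> bool}).

Definition walsh_coef (p : R) S (h : R) : R :=
  \sum_w character R S w * `|2 * (weight w)%:R - h| `^ p.

Lemma weight0 : weight zero = 0%N.
Proof. by rewrite /weight big1 // => j _; rewrite ffunE. Qed.

Lemma weight_gt0 w : w != zero -> (0 < weight w)%N.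
Proof.
apply: contraNT; rewrite -eqn0Ngt sum_nat_eq0 => /forallP w0.
by apply/eqP/ffunP => j; rewrite ffunE; have := w0 j; case: (w j).
Qed.

Lemma weight_le w : (weight w <= k)%N.
Proof.
rewrite /weight -[X in (_ <= X)%N]card_ord -sum1_card leq_sum // => j _.
exact: leq_b1.
Qed.

Lemma character0r S : character R S zero = 1.
Proof. by rewrite characterC character0l. Qed.

Lemma walsh_coef0_gt0 p h : 0 < h -> 0 < walsh_coef p zero h.
Proof.
move=> h_gt0; rewrite /walsh_coef (bigD1 zero) //= ltr_wpDr //.
  by apply: sumr_ge0 => w _; rewrite character0l mul1r powR_ge0.
by rewrite character0l mul1r weight0 mulr0 sub0r normrN powR_gt0 // normr_gt0 gt_eqF.
Qed.

Lemma even_integer_nat (p : R) : 1 <= p -> even_integer p ->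
  exists2 n : nat, p = n%:R & ~~ odd n.
Proof.
move=> p_ge1 [z pE]; have z_gt0 : 0 < z%:~R :> R by move: p_ge1; rewrite pE; lra.
rewrite ltr0z in z_gt0; case: z z_gt0 pE => // n _ ->; exists (2 * n)%N.
  by rewrite natrM.
by rewrite oddM.
Qed.

Lemma powR_norm_even (x : R) n : ~~ odd n -> `|x| `^ n%:R = x ^+ n.
Proof. by move=> en; rewrite powR_mulrn // -normrX ger0_norm // exprn_even_ge0. Qed.

(** Otherwise the character would be orthogonal to every polynomial of degree at most [n] in
    [2 * weight w], including one that is nonzero only at the zero word. *)
Lemma moment_neq0 S (n : nat) : (k <= n)%N ->
  exists2 l, (l <= n)%N & \sum_w character R S w * (2 * (weight w)%:R) ^+ l != 0.
Proof.
move=> kn; have [//|no_moment] := pselect (exists2 l, (l <= n)%N &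
  \sum_w character R S w * (2 * (weight w)%:R) ^+ l != 0).
(* [g] has degree [k] and vanishes at every [2 * weight w] except [0]. *)
pose g : {poly R} := \prod_(j <- enum 'I_k) ('X - (2 * j.+1%:R)%:P).
have size_g : size g = k.+1.
  by rewrite size_prod_XsubC size_enum_ord.
have sum0 : \sum_w character R S w * g.[2 * (weight w)%:R] = 0.
  under eq_bigr do rewrite horner_coef mulr_sumr.
  rewrite exchange_big big1 //= => l _.
  under eq_bigr do rewrite mulrCA.
  rewrite -mulr_sumr; apply/eqP; rewrite mulf_eq0; apply/orP; right.
  apply/negP => /negP h; apply: no_moment; exists l => //.
  by rewrite (leq_trans _ kn) // -ltnS -size_g ltn_ord.
have g_root w : w != zero -> g.[2 * (weight w)%:R] = 0.
  move=> /weight_gt0 w_gt0; have lt_wk : ((weight w).-1 < k)%N.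
    by rewrite prednK // weight_le.
  rewrite /g horner_prod big_enum /= (bigD1 (Ordinal lt_wk)) //= hornerXsubC prednK //.
  by rewrite subrr mul0r.
move: sum0; rewrite (bigD1 zero) //= big1 ?addr0 => [|w /g_root ->]; last first.
  by rewrite mulr0.
rewrite character0r mul1r weight0 mulr0 /g horner_prod big_enum /= => /eqP.
move=> /prodf_eq0[j _]; rewrite hornerXsubC sub0r oppr_eq0.
by rewrite mulf_eq0 !pnatr_eq0.
Qed.

Lemma near_walsh_coef_neq0 p S : 1 <= p -> ~ even_integer p \/ k%:R <= p ->
  \forall h \near 0^'+, walsh_coef p S h != 0.
Proof.
move=> p_ge1 pk; have [->|S_neq0] := eqVneq S zero.
  by apply: filterS (nbhs_right_gt 0) => h /(walsh_coef0_gt0 p)/gt_eqF ->.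
have [even_p|odd_p] := pselect (even_integer p).
  have {pk} kp : k%:R <= p by case: pk.
  have [n pE en] := even_integer_nat p_ge1 even_p.
  rewrite pE ler_nat in kp; have [l ln nz] := moment_neq0 S kp.
  apply: filterS (near_moment_sum ln nz) => h; rewrite /walsh_coef pE.
  by under [in X in _ -> X]eq_bigr do rewrite powR_norm_even //.
(* The zero word supplies the singular term [h ^ p] with coefficient 1. Its entry in the smooth part
   is a dummy: [b] cancels it, and the value 2 respects the lower bound on [a]. *)
pose a w : R := if w == zero then 2 else 2 * (weight w)%:R.
pose b w : R := if w == zero then 0 else character R S w.
have a_ge2 w : 2 <= a w.
  rewrite /a; case: eqP => // /eqP/weight_gt0 w_gt0.
  by rewrite ler_peMr // ler1n.
have sum_b : \sum_w b w = -1.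
  rewrite (bigD1 zero) //= {1}/b eqxx add0r.
  rewrite (eq_bigr (fun w => character R S w)) => [|w]; last first.
    by rewrite /b => /negbTE ->.
  have : \sum_w character R S w = 0.
    by under eq_bigr do rewrite characterC; rewrite sum_character (negbTE S_neq0).
  by rewrite (bigD1 zero) //= character0r => h; lra.
have := near_pow_sum a_ge2 (n := (Num.truncn p).+1) (q := p) (b := b) (oner_neq0 R).
move=> /(_ (truncnS_gt _)) nz; near=> h.
have h_gt0 : 0 < h by near: h; exact: nbhs_right_gt.
have h_lt1 : h < 1 by near: h; exact: nbhs_right_lt.
have -> : walsh_coef p S h = pow_sum a p 1 b h.
  rewrite /walsh_coef /pow_sum [in LHS](bigD1 zero) //= [in RHS](bigD1 zero) //=.
  rewrite {1}/b eqxx mul0r add0r character0r weight0 mulr0 sub0r normrN gtr0_norm //.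
  congr (_ + _); apply: eq_bigr => w w_neq0.
  rewrite /a /b (negbTE w_neq0) ger0_norm // subr_ge0.
  have : (1 : R) <= (weight w)%:R by rewrite ler1n weight_gt0.
  lra.
(* For an integer exponent [m] the condition reads [1 - (-1) ^ m != 0], which fails only if [m], and
   hence [p], is even. *)
near: h; apply: nz => m pE; rewrite sum_b -signr_odd mulrN1.
case: (boolP (odd m)) => odd_m; first by rewrite expr1 opprK gt_eqF // addr_gt0.
case: odd_p; exists (m./2 : int); rewrite pE -{1}[m]odd_double_half (negbTE odd_m).
by rewrite add0n -mul2n natrM.
Unshelve. all: by end_near. Qed.

(** Finitely many characters admit a common threshold [d], and some [1 / (m + 2)] lies below it.
    Offsets indexed by naturals are what a search can range over. *)
Lemma exists_walsh_coef_neq0 p : 1 <= p -> ~ even_integer p \/ k%:R <= p ->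
  exists m : nat, forall S, walsh_coef p S m.+2%:R^-1 != 0.
Proof.
move=> p_ge1 pk.
have /near_right0P[d d_gt0 hd] : \forall h \near 0^'+, forall S, walsh_coef p S h != 0.
  by apply: filter_forall => S; exact: near_walsh_coef_neq0.
exists (Num.truncn d^-1) => S; apply: hd; rewrite invr_gt0 ltr0n /=.
rewrite -[X in _ < X]invrK ltf_pV2 ?posrE ?invr_gt0 ?ltr0n //.
by rewrite (lt_trans (truncnS_gt _)) // ltr_nat.
Qed.

(* A monomial of degree [n < k] misses some coordinate, and flipping that
   coordinate changes the sign of the character. *)
Lemma alternating_power_sum (v : 'I_k -> R) (s : R) n : (n < k)%N ->
  \sum_y character R ones y * (\sum_j v j * (y j)%:R - s) ^+ n = 0.
Proof.
(* Index 0 of ['I_k.+1] stands for the constant term [- s], the other indices for the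
   coordinates. *)
move=> nk; pose T o y : R := if unlift ord0 o is Some j then v j * (y j)%:R else - s.
have expand y : (\sum_j v j * (y j)%:R - s) ^+ n =
    \sum_(g : {ffun 'I_n -> 'I_k.+1}) \prod_l T (g l) y.
  rewrite -(bigA_distr_bigA (fun _ o => T o y)) prodr_const card_ord; congr (_ ^+ _).
  rewrite big_ord_recl {1}/T unlift_none addrC; congr (_ + _).
  by apply: eq_bigr => j _; rewrite /T liftK.
under eq_bigr do rewrite expand mulr_sumr.
rewrite exchange_big big1 //= => g _.
have [j /forallP jg] : exists j, [forall l, g l != lift ord0 j].
  apply/existsP; rewrite -[X in is_true X]negbK negb_exists; apply/negP => /forallP h.
  have : codom (lift (@ord0 k)) \subset codom g.
    apply/fintype.subsetP => _ /codomP[j ->].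
    have := h j; rewrite negb_forall => /existsP[l]; rewrite negbK => /eqP <-.
    exact: codom_f.
  move/subset_leq_card; rewrite card_codom; last exact: lift_inj.
  rewrite card_ord => le_k; have := leq_trans le_k (leq_image_card _ _).
  by rewrite card_ord leqNgt nk.
pose e : {ffun 'I_k -> bool} := [ffun i => i == j].
have chi_e : character R ones e = -1.
  rewrite /character (bigD1 j) //= !ffunE eqxx expr1 big1 ?mulr1 // => i /negbTE ij.
  by rewrite !ffunE ij.
set X := (X in X = 0); suff XN : X = - X by lra.
rewrite {1}/X (reindex_inj (inv_inj (xorK e))) /X -sumrN; apply: eq_bigr => y _ /=.
rewrite character_xor chi_e mulrN1 mulNr; congr (- (_ * _)).
apply: eq_bigr => l _; rewrite /T; case: unliftP => // i gl.
rewrite !ffunE; have /negbTE -> : i != j; last by rewrite addbF.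
by apply: contra (jg l) => /eqP <-; rewrite gl.
Qed.

Lemma no_isolating_parallelepiped p d (V : 'M[R]_(d, k)) (t : 'cV[R]_d) :
  (0 < k)%N -> 1 <= p -> even_integer p -> p < k%:R ->
  ~ isolating_parallelepiped p V t.
Proof.
move=> k_gt0 p_ge1 /(even_integer_nat p_ge1)[n pE en].
have n_gt0 : (0 < n)%N by move: p_ge1; rewrite pE ler1n.
rewrite pE ltr_nat => nk [V1 t1].
pose x y : 'cV[R]_k := \col_j (y j)%:R.
pose N y : R := \sum_i ((V *m x y - t) i 0) ^+ n.
have N1 y : y != zero -> N y = 1.
  move=> y_neq0; have := V1 (x y); rewrite /lpnorm => /(_ _ _)/eqP.
  rewrite powR_eq1 invr_eq0 pnatr_eq0 (gtn_eqF n_gt0) orbF.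
  rewrite ltNge sumr_ge0 //= ?orbF; last by move=> i _; exact: powR_ge0.
  rewrite /N (eq_bigr (fun i => ((V *m x y - t) i 0) ^+ n)); last first.
    by move=> i _; rewrite powR_norm_even.
  move=> h; apply/eqP/h.
    by move=> j; rewrite mxE; case: (y j); [right|left].
  move=> xy; case/eqP: y_neq0; apply/ffunP => j; rewrite ffunE.
  have := congr1 (fun M : 'cV[R]_k => M j 0) xy; rewrite !mxE.
  by case: (y j) => //= /eqP; rewrite oner_eq0.
have sumN : \sum_y character R ones y * N y = 0.
  under eq_bigr do rewrite mulr_sumr.
  rewrite exchange_big big1 //= => i _.
  rewrite -[RHS](alternating_power_sum (V i) (t i 0) nk); apply: eq_bigr => y _.
  by rewrite !mxE; congr (_ * (_ - _) ^+ _); apply: eq_bigr => j _; rewrite mxE.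
have ones_neq0 : ones != zero.
  by apply/eqP => /ffunP/(_ (Ordinal k_gt0)); rewrite !ffunE.
(* The constant 1 also has alternating sum zero and agrees with [N] away from [zero], so the two
   agree at [zero] as well. *)
have : \sum_y character R ones y = 0.
  by under eq_bigr do rewrite characterC; rewrite sum_character (negbTE ones_neq0).
move: sumN; rewrite !(bigD1 zero (P := xpredT)) //= character0r !mul1r.
under eq_bigr => y /N1 Ny do rewrite Ny mulr1.
move=> h1 h2; have N01 : N zero = 1 by lra.
move: t1; rewrite /lpnorm (_ : \sum_i _ = 1) ?powR1 ?ltxx //.
transitivity (N zero) => //; apply: eq_bigr => i _; rewrite powR_norm_even // !mxE.
rewrite big1 ?sub0r => [|j _]; last by rewrite mxE ffunE mulr0.
by rewrite exprNn -signr_odd (negbTE en) mul1r.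
Qed.

End Eigenvalues.

(** * The construction *)

Section Construction.
Variable R : realType.

Definition popcount (k w : nat) : nat := (\sum_(0 <= j < k) bit w j)%N.

Definition chi (k S w : nat) : R :=
  (-1) ^+ (\sum_(0 <= j < k) (bit S j && bit w j))%N.

Definition lam (p : R) (k m S : nat) : R :=
  \sum_(0 <= w < 2 ^ k) chi k S w * `|2 * (popcount k w)%:R - m.+2%:R^-1| `^ p.

Definition lam_prod (p : R) (k m : nat) : R := \prod_(0 <= S < 2 ^ k) lam p k m S.

(** This replaces the quotient of [lam_prod] by [lam] at [S], without a division by a number that
    might vanish. *)
Definition lam_coprod (p : R) (k m S : nat) : R :=
  \prod_(0 <= S' < 2 ^ k) (if S' == S then 1 else lam p k m S').

(* Large enough to make [alpha] positive, as [x ^ 2 + y ^ 2 +- x y >= 0]. *)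
Definition base (p : R) (k m : nat) : R :=
  1 + \sum_(0 <= S < 2 ^ k) (lam_prod p k m ^+ 2 + lam_coprod p k m S ^+ 2).

Definition alpha (p : R) (k m u : nat) : R := base p k m +
  \sum_(0 <= S < 2 ^ k) chi k S u * (lam_prod p k m * lam_coprod p k m S).

Definition scale (p : R) (k m : nat) : R := base p k m * lam p k m 0.

(** Row [i] before scaling by [beta]: the columns [j < k] belong to the matrix, the last one to the
    target vector. *)
Definition direction (k m i j : nat) : R :=
  if (j < k)%N then 2 * (-1) ^+ bit i j else m.+2%:R^-1 - 2 * (popcount k i)%:R.

Definition beta (p : R) (k m i : nat) : R :=
  (alpha p k m i / scale p k m) `^ p^-1.

Definition isolating_matrix (p : R) (k m : nat) : 'M[R]_((2 ^ k)%N, k + 1) :=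
  \matrix_(i, j) (beta p k m i * direction k m i j).

Lemma chiE k S w : chi k S w = character R (bits k S) (bits k w).
Proof.
rewrite /chi /character expr_sum big_mkord; apply: eq_bigr => j _.
by rewrite !ffunE.
Qed.

Lemma popcountE k w : popcount k w = weight (bits k w).
Proof.
by rewrite /popcount /weight big_mkord; apply: eq_bigr => j _; rewrite ffunE.
Qed.

Lemma lamE p k m S : lam p k m S = walsh_coef p (bits k S) m.+2%:R^-1.
Proof.
rewrite /walsh_coef -sum_bits; apply: eq_bigr => w _.
by rewrite chiE popcountE.
Qed.

Lemma bits0 k : bits k 0 = [ffun=> false].
Proof. by apply/ffunP => j; rewrite !ffunE /bit div0n. Qed.

Lemma lam0_gt0 p k m : 0 < lam p k m 0.
Proof. by rewrite lamE bits0 walsh_coef0_gt0 // invr_gt0 ltr0n. Qed.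

Lemma chi_cases k S w : chi k S w = 1 \/ chi k S w = -1.
Proof. by rewrite /chi -signr_odd; case: (odd _); [right|left]. Qed.

Lemma base_ge1 p k m : 1 <= base p k m.
Proof. by rewrite lerDl sumr_ge0 // => S _; rewrite addr_ge0 // sqr_ge0. Qed.

Lemma alpha_gt0 p k m u : 0 < alpha p k m u.
Proof.
rewrite /alpha /base -addrA -big_split /= ltr_pwDl // sumr_ge0 // => S _.
set x := lam_prod _ _ _; set y := lam_coprod _ _ _ _.
have := sqr_ge0 (x + y); have := sqr_ge0 (x - y).
have := sqr_ge0 x; have := sqr_ge0 y.
by case: (chi_cases k S u) => ->; rewrite !expr2; nra.
Qed.

Lemma scale_gt0 p k m : 0 < scale p k m.
Proof. by rewrite mulr_gt0 ?lam0_gt0 // (lt_le_trans _ (base_ge1 _ _ _)). Qed.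

Lemma beta_gt0 p k m i : 0 < beta p k m i.
Proof. by rewrite powR_gt0 // divr_gt0 ?alpha_gt0 ?scale_gt0. Qed.

Lemma beta_powR p k m i : 0 < p -> beta p k m i `^ p = alpha p k m i / scale p k m.
Proof.
move=> p_gt0; rewrite /beta -powRrM mulVf ?gt_eqF // powRr1 //.
by rewrite ltW // divr_gt0 ?alpha_gt0 ?scale_gt0.
Qed.

Lemma lam_coprodE p k m S : (S < 2 ^ k)%N ->
  lam_coprod p k m S * lam p k m S = lam_prod p k m.
Proof.
move=> Sk; rewrite /lam_coprod /lam_prod.
rewrite (bigD1_seq S) ?iota_uniq ?mem_index_iota //= eqxx mul1r.
rewrite [RHS](bigD1_seq S) ?iota_uniq ?mem_index_iota //= mulrC; congr (_ * _).
by apply: eq_bigr => S' /negbTE ->.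
Qed.

(* The weights [alpha] have Fourier coefficients inverse to the eigenvalues
   [lam], up to the constant [base] and the common factor [lam_prod]. *)
Lemma sum_alpha p k m (y : {ffun 'I_k -> bool}) :
  \sum_(0 <= i < 2 ^ k) alpha p k m i *
    `|2 * (weight (xor (bits k i) y))%:R - m.+2%:R^-1| `^ p =
  scale p k m +
  lam_prod p k m ^+ 2 * (if y == [ffun=> false] then 2 ^+ k else 0).
Proof.
pose f n := `|2 * n%:R - m.+2%:R^-1| `^ p : R.
have conv S : \sum_(0 <= i < 2 ^ k) chi k S i * f (weight (xor (bits k i) y)) =
    character R (bits k S) y * lam p k m S.
  rewrite lamE /walsh_coef -(sum_character_xor _ _ f) -sum_bits.
  by apply: eq_bigr => i _; rewrite chiE.
have sum0 : \sum_(0 <= i < 2 ^ k) f (weight (xor (bits k i) y)) = lam p k m 0.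
  have := conv 0%N; rewrite bits0 character0l mul1r => <-.
  by apply: eq_bigr => i _; rewrite chiE bits0 character0l mul1r.
rewrite -/f; under eq_bigr do rewrite /alpha mulrDl.
rewrite big_split /= -mulr_sumr sum0; congr (_ + _).
under eq_bigr do rewrite mulr_suml.
(* Since [lam_coprod * lam = lam_prod], every character ends up with the same coefficient
   [lam_prod ^ 2], and the characters add up to a bump at 0. *)
rewrite exchange_big /= -sum_character -sum_bits mulr_sumr.
apply: eq_big_nat => S /andP[_ Sk].
rewrite (eq_bigr (fun i => lam_prod p k m * lam_coprod p k m S *
  (chi k S i * f (weight (xor (bits k i) y))))) => [|i _]; last by rewrite /f; ring.
rewrite -mulr_sumr conv [_ * lam _ _ _ _]mulrC mulrA -[_ * _ * lam _ _ _ _]mulrA.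
by rewrite lam_coprodE // expr2.
Qed.

(** For bits [u] and [y], the sum [u + (-1) ^ u * y] is their exclusive or; adding this over the
    coordinates turns the linear form into a weight. *)
Lemma isolating_matrixE p k m (i : 'I_(2 ^ k)) (y : {ffun 'I_k -> bool}) :
  (lsubmx (isolating_matrix p k m) *m (\col_j (y j)%:R)
     - rsubmx (isolating_matrix p k m)) i 0 =
  beta p k m i * (2 * (weight (xor (bits k i) y))%:R - m.+2%:R^-1).
Proof.
rewrite !mxE /= /direction addn0 ltnn popcountE.
under eq_bigr => j _ do rewrite !mxE /= /direction ltn_ord -mulrA.
rewrite -mulr_sumr -mulrBr; congr (_ * _).
suff -> : 2 * (weight (xor (bits k i) y))%:R =
    \sum_(j < k) 2 * (-1) ^+ bit i j * (y j)%:R + 2 * (weight (bits k i))%:R :> R by ring.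
rewrite /weight !natr_sum !mulr_sumr -big_split; apply: eq_bigr => j _ /=.
rewrite !ffunE; case: (bit i j); case: (y j);
  by rewrite /= ?expr0 ?expr1 ?mulr0 ?mulr1 ?addr0 ?add0r // mulrN1 addNr.
Qed.

Lemma lpnorm_isolating_matrix p k m (y : {ffun 'I_k -> bool}) : 1 <= p ->
  \sum_i `|(lsubmx (isolating_matrix p k m) *m (\col_j (y j)%:R)
     - rsubmx (isolating_matrix p k m)) i 0| `^ p =
  1 + lam_prod p k m ^+ 2 * (if y == [ffun=> false] then 2 ^+ k else 0) / scale p k m.
Proof.
move=> p_ge1; have p_gt0 : 0 < p by lra.
have s_gt0 := scale_gt0 p k m.
rewrite -[X in _ = X + _](divff (lt0r_neq0 s_gt0)) -mulrDl -sum_alpha.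
rewrite big_mkord mulr_suml.
apply: eq_bigr => i _; rewrite isolating_matrixE normrM powRM //.
by rewrite (gtr0_norm (beta_gt0 _ _ _ _)) beta_powR // mulrAC.
Qed.

(** The [p]-th power of the norm is 1 off the origin; at the origin it exceeds 1 by a positive
    multiple of [lam_prod ^ 2]. *)
Lemma isolating_matrixP p k m : 1 <= p -> lam_prod p k m != 0 ->
  isolating_parallelepiped p (lsubmx (isolating_matrix p k m))
    (rsubmx (isolating_matrix p k m)).
Proof.
move=> p_ge1 P_neq0; split=> [x x01 x_neq0|].
  pose y : {ffun 'I_k -> bool} := [ffun j => x j 0 == 1].
  have xE : x = \col_j (y j)%:R.
    apply/matrixP => j j'; rewrite ord1 !mxE ffunE.
    by case: (x01 j) => ->; rewrite ?eqxx // eq_sym oner_eq0.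
  have y_neq0 : y != [ffun=> false].
    apply/eqP => y0; apply: x_neq0; rewrite xE y0.
    by apply/matrixP => j j'; rewrite !mxE ffunE.
  rewrite /lpnorm xE lpnorm_isolating_matrix // (negbTE y_neq0).
  by rewrite mulr0 mul0r addr0 powR1.
have := @lpnorm_isolating_matrix p k m [ffun=> false] p_ge1; rewrite eqxx.
set N := (N in N = _) => NE.
have -> : lpnorm p (rsubmx (isolating_matrix p k m)) = N `^ p^-1.
  rewrite /lpnorm /N; congr (_ `^ _); apply: eq_bigr => i _.
  have -> : \col_j ([ffun=> false] j)%:R = 0 :> 'cV[R]_k.
    by apply/matrixP => j j'; rewrite !mxE ffunE.
  by rewrite mulmx0 sub0r [in RHS]mxE normrN.
have N_gt1 : 1 < N.
  rewrite NE ltrDl divr_gt0 ?scale_gt0 // mulr_gt0 //.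
    by rewrite exprn_even_gt0.
  exact: exprn_gt0.
have : 0 < p^-1 by rewrite invr_gt0; lra.
move/gt0_ltr_powR => /(_ 1 N); rewrite powR1; apply => //.
  by rewrite nnegrE.
by rewrite nnegrE; lra.
Qed.

Lemma exists_lam_prod_neq0 p k : 1 <= p -> ~ even_integer p \/ k%:R <= p ->
  exists m, lam_prod p k m != 0.
Proof.
move=> p_ge1 /(exists_walsh_coef_neq0 p_ge1)[m hm]; exists m.
rewrite /lam_prod big_mkord; apply/prodf_neq0 => S _.
by rewrite lamE hm.
Qed.

End Construction.

(** * The algorithm *)

Section Computability.
Variable R : realType.
Implicit Types K M S U I J : seq nat -> nat.

Lemma cbool_bit a F G :
  cnat a F -> cnat a G -> cbool a (fun phi v => bit (F phi v) (G phi v)).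
Proof.
move=> cF cG; apply: cbool_odd; apply: cnat_div => //.
by apply: cnat_exp => //; exact: cnat_const.
Qed.

Lemma crat_const (c : nat) a : crat a (fun _ _ => c%:R : R).
Proof. exact/crat_nat/cnat_const. Qed.

Lemma crat_sign a N : cnat a N -> crat a (fun phi v => (-1) ^+ N phi v : R).
Proof.
move=> cN; apply: crat_ext (crat_if (cbool_odd cN)
  (crat_opp (crat_const 1 a)) (crat_const 1 a)) => phi v _.
by rewrite -signr_odd; case: (odd _).
Qed.

Lemma cnat_popcount a F G : cnat a F -> cnat a G ->
  cnat a (fun phi v => popcount (F phi v) (G phi v)).
Proof.
move=> cF cG; apply: cnat_sum => //=.
by apply: cbool_bit; [exact: cnat_behead cG|exact: cnat_nth].
Qed.

Lemma crat_chi a K S U : cnat a (fun _ v => K v) -> cnat a (fun _ v => S v) ->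
  cnat a (fun _ v => U v) -> crat a (fun _ v => chi R (K v) (S v) (U v)).
Proof.
move=> cK cS cU; apply: crat_sign; apply: cnat_sum => //=.
by apply: cbool_and; apply: cbool_bit;
  [exact: (cnat_behead cS)|exact: cnat_nth|exact: (cnat_behead cU)|exact: cnat_nth].
Qed.

Lemma crat_offset a K M U : cnat a (fun _ v => K v) -> cnat a (fun _ v => M v) ->
  cnat a (fun _ v => U v) ->
  crat a (fun _ v => 2 * (popcount (K v) (U v))%:R - (M v).+2%:R^-1 : R).
Proof.
move=> cK cM cU; apply: crat_add.
  by apply: crat_mul; [exact: crat_const|exact/crat_nat/cnat_popcount].
apply: crat_opp; apply: crat_ext (crat_divS (crat_const 1 a) (cnat_S cM)) => phi v _.
by rewrite mul1r.
Qed.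

Lemma cball_lam a K M S : cnat a (fun _ v => K v) -> cnat a (fun _ v => M v) ->
  cnat a (fun _ v => S v) -> cball a (fun p v => lam p (K v) (M v) (S v) : R).
Proof.
move=> cK cM cS; apply: cball_sum; first exact: (cnat_exp (cnat_const _ 2) cK).
apply: cball_mul.
  apply: cball_crat; apply: crat_chi.
  - exact: (cnat_behead cK).
  - exact: (cnat_behead cS).
  exact: cnat_nth.
apply: cball_powR => [v _|]; first exact: normr_ge0.
apply: crat_norm; apply: crat_offset.
- exact: (cnat_behead cK).
- exact: (cnat_behead cM).
exact: cnat_nth.
Qed.

Lemma cball_lam_prod a K M : cnat a (fun _ v => K v) -> cnat a (fun _ v => M v) ->
  cball a (fun p v => lam_prod p (K v) (M v) : R).
Proof.
move=> cK cM; apply: cball_prod; first exact: (cnat_exp (cnat_const _ 2) cK).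
apply: cball_lam; [exact: (cnat_behead cK)|exact: (cnat_behead cM)|exact: cnat_nth].
Qed.

Lemma cball_const (c : nat) a : cball a (fun _ _ => c%:R : R).
Proof. exact: (cball_crat (crat_const c a)). Qed.

Lemma cball_if a (b : seq nat -> bool) (X Y : R -> seq nat -> R) :
  cbool a (fun _ v => b v) -> cball a X -> cball a Y ->
  cball a (fun p v => if b v then X p v else Y p v).
Proof.
move=> cb cX cY.
apply: cball_ext (cball_add (cball_mul (cball_crat (crat_nat R cb)) cX)
  (cball_mul (cball_crat (crat_nat R (cbool_neg cb))) cY)) => p v _.
by case: (b v); rewrite /= mul1r mul0r ?addr0 ?add0r.
Qed.

Lemma cball_lam_coprod a K M S : cnat a (fun _ v => K v) ->
  cnat a (fun _ v => M v) -> cnat a (fun _ v => S v) ->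
  cball a (fun p v => lam_coprod p (K v) (M v) (S v) : R).
Proof.
move=> cK cM cS; apply: cball_prod; first exact: (cnat_exp (cnat_const _ 2) cK).
apply: cball_if; [|exact: (cball_const 1)|].
  by apply: cbool_eq; [exact: cnat_nth|exact: (cnat_behead cS)].
apply: cball_lam; [exact: (cnat_behead cK)|exact: (cnat_behead cM)|exact: cnat_nth].
Qed.

Lemma cball_base a K M : cnat a (fun _ v => K v) -> cnat a (fun _ v => M v) ->
  cball a (fun p v => base p (K v) (M v) : R).
Proof.
move=> cK cM; apply: cball_add; first exact: (cball_const 1).
apply: cball_sum; first exact: (cnat_exp (cnat_const _ 2) cK).
have cP : cball a.+1 (fun p v => lam_prod p (K (behead v)) (M (behead v)) : R).
  by apply: cball_lam_prod; [exact: (cnat_behead cK)|exact: (cnat_behead cM)].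
have cC : cball a.+1 (fun p v =>
    lam_coprod p (K (behead v)) (M (behead v)) (nth 0%N v 0) : R).
  by apply: cball_lam_coprod;
    [exact: (cnat_behead cK)|exact: (cnat_behead cM)|exact: cnat_nth].
exact: (cball_add (cball_mul cP cP) (cball_mul cC cC)).
Qed.

Lemma cball_alpha a K M U : cnat a (fun _ v => K v) ->
  cnat a (fun _ v => M v) -> cnat a (fun _ v => U v) ->
  cball a (fun p v => alpha p (K v) (M v) (U v) : R).
Proof.
move=> cK cM cU; apply: cball_add; first exact: cball_base.
apply: cball_sum; first exact: (cnat_exp (cnat_const _ 2) cK).
have cK' := cnat_behead cK; have cM' := cnat_behead cM.
apply: cball_mul; last apply: cball_mul.
- apply: cball_crat; apply: crat_chi => //; first exact: cnat_nth.
  exact: (cnat_behead cU).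
- exact: cball_lam_prod.
by apply: cball_lam_coprod => //; exact: cnat_nth.
Qed.

Lemma cball_scale a K M : cnat a (fun _ v => K v) -> cnat a (fun _ v => M v) ->
  cball a (fun p v => scale p (K v) (M v) : R).
Proof.
move=> cK cM; apply: cball_mul; first exact: cball_base.
by apply: cball_lam => //; exact: (cnat_const a 0).
Qed.

Lemma crat_direction a K M I J : cnat a (fun _ v => K v) ->
  cnat a (fun _ v => M v) -> cnat a (fun _ v => I v) ->
  cnat a (fun _ v => J v) ->
  crat a (fun _ v => direction R (K v) (M v) (I v) (J v)).
Proof.
move=> cK cM cI cJ; apply: crat_if; first exact: (cbool_leq (cnat_S cJ) cK).
  apply: crat_mul; first exact: crat_const.
  by apply: crat_sign; exact: cbool_bit.
apply: crat_ext (crat_opp (crat_offset cK cM cI)) => phi v _.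
by rewrite opprB.
Qed.

End Computability.

(** Code of [c] or [- c]: the odd code [2 c - 1] denotes [- c], and for [c = 0] truncation gives the
    code 0 of zero. *)
Definition signed_code (b : bool) (c : nat) : nat :=
  if b then (2 * c).-1 else (2 * c)%N.

Lemma int_of_signed_code (b : bool) c :
  int_of_code (signed_code b c) = (-1) ^+ b * c%:Z.
Proof.
rewrite /int_of_code /signed_code mul2n; case: b; rewrite ?expr0 ?expr1 ?mul1r.
  case: c => [|c]; first by rewrite /= mulr0.
  by rewrite doubleS /= odd_double /= uphalf_double NegzE mulN1r.
by rewrite odd_double doubleK.
Qed.

(** Because [0 < 1 / (m + 2) < 1], signs are decided exactly and independently of [m]; only absolute
    values need approximation. *)
Definition direction_sign (k i j : nat) : bool :=
  if (j < k)%N then bit i j else (0 < popcount k i)%N.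

(** * Search programs for the offset and the entries *)

Section Output.
Variable R : realType.

Lemma directionE k m i j : direction R k m i j =
  (-1) ^+ direction_sign k i j * `|direction R k m i j|.
Proof.
rewrite /direction /direction_sign; case: ifP => _.
  by rewrite normrM normr_nat normrX normrN1 expr1n mulr1 mulrC.
have h_gt0 : 0 < m.+2%:R^-1 :> R by rewrite invr_gt0 ltr0n.
have h_lt1 : m.+2%:R^-1 < 1 :> R by rewrite invf_lt1 ?ltr0n // ltr1n.
move: (m.+2%:R^-1) h_gt0 h_lt1 => h h_gt0 h_lt1.
case: (popcount k i) => [|n]; rewrite ?expr0 ?expr1 ?mul1r ?mulN1r.
  by rewrite mulr0 subr0 gtr0_norm.
rewrite ltr0_norm ?opprK // -natr1; have : 0 <= n%:R :> R by [].
lra.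
Qed.

Lemma direction_neq0 k m i j : direction R k m i j != 0.
Proof.
rewrite /direction; case: ifP => _; first by rewrite mulf_neq0 ?signr_eq0 ?pnatr_eq0.
have h_gt0 : 0 < m.+2%:R^-1 :> R by rewrite invr_gt0 ltr0n.
have h_lt1 : m.+2%:R^-1 < 1 :> R by rewrite invf_lt1 ?ltr0n // ltr1n.
move: (m.+2%:R^-1) h_gt0 h_lt1 => h h_gt0 h_lt1.
case: (popcount k i) => [|n]; first by rewrite mulr0 subr0 gt_eqF.
by rewrite lt_eqF // -natr1; have : 0 <= n%:R :> R by []; lra.
Qed.

Lemma ltr_powR_mono (p x y : R) : 0 < p -> 0 <= x -> 0 <= y ->
  (x `^ p < y `^ p) = (x < y).
Proof.
move=> p_gt0 x_ge0 y_ge0; apply/idP/idP => [|xy]; last first.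
  by apply: gt0_ltr_powR; rewrite ?nnegrE.
rewrite !ltNge; apply: contra => yx.
by apply: ge0_ler_powR; rewrite ?nnegrE // ltW.
Qed.

(* [c / 2 ^ q], with a denominator of the shape required by [crat_divS]. *)
Definition grid (c q : nat) : R := c%:R / (2 ^ q).-1.+1%:R.

Lemma gridE c q : grid c q = c%:R / 2 ^+ q.
Proof. by rewrite /grid prednK ?expn_gt0 // natrX. Qed.

Lemma grid_ge0 c q : 0 <= grid c q.
Proof. by rewrite divr_ge0. Qed.

Lemma crat_grid a F G : cnat a F -> cnat a G ->
  crat a (fun phi v => grid (F phi v) (G phi v)).
Proof.
move=> cF cG; apply: crat_divS; first exact: crat_nat.
by apply: cnat_pred; apply: cnat_exp => //; exact: cnat_const.
Qed.

(** The comparison of a grid point with an entry, raised to the power [p] and cleared of the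
    division by [scale]; no root or reciprocal has to be enclosed. *)
Definition grid_below (p : R) (k m i j q c : nat) : Prop :=
  grid c q `^ p * scale p k m < `|direction R k m i j| `^ p * alpha p k m i.

Definition grid_above (p : R) (k m i j q c : nat) : Prop :=
  `|direction R k m i j| `^ p * alpha p k m i < grid c q `^ p * scale p k m.

Definition entry_norm (p : R) (k m i j : nat) : R :=
  `|direction R k m i j| * beta p k m i.

Lemma entry_norm_gt0 p k m i j : 0 < entry_norm p k m i j.
Proof. by rewrite mulr_gt0 ?beta_gt0 // normr_gt0 direction_neq0. Qed.

Lemma entry_norm_powR p k m i j : 0 < p ->
  `|direction R k m i j| `^ p * alpha p k m i =
  entry_norm p k m i j `^ p * scale p k m.
Proof.
move=> p_gt0; rewrite powRM ?(ltW (beta_gt0 _ _ _ _)) // beta_powR // -mulrA.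
by rewrite divfK // gt_eqF // scale_gt0.
Qed.

Lemma grid_belowP p k m i j q c : 0 < p ->
  grid_below p k m i j q c <-> grid c q < entry_norm p k m i j.
Proof.
move=> p_gt0; rewrite /grid_below entry_norm_powR // ltr_pM2r ?scale_gt0 //.
by rewrite ltr_powR_mono // ?grid_ge0 // ltW // entry_norm_gt0.
Qed.

Lemma grid_aboveP p k m i j q c : 0 < p ->
  grid_above p k m i j q c <-> entry_norm p k m i j < grid c q.
Proof.
move=> p_gt0; rewrite /grid_above entry_norm_powR // ltr_pM2r ?scale_gt0 //.
by rewrite ltr_powR_mono // ?grid_ge0 // ltW // entry_norm_gt0.
Qed.

(** A bracket reaching one step to either side of [c] keeps both inequalities strict, hence
    certifiable, even when the entry lies on the grid; at [c = 0] the lower one is positivity. *)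
Lemma exists_grid_bracket p k m i j q :
  exists c, grid c.-1 q < entry_norm p k m i j < grid c.+1 q.
Proof.
have y_gt0 := entry_norm_gt0 p k m i j; set y := entry_norm _ _ _ _ _ in y_gt0 *.
have e_gt0 : 0 < 2 ^+ q :> R by rewrite exprn_gt0.
exists (Num.truncn (y * 2 ^+ q)); rewrite !gridE ltr_pdivrMr // ltr_pdivlMr //.
have /truncn_itv/andP[h ->] : 0 <= y * 2 ^+ q by rewrite ltW // mulr_gt0.
rewrite andbT; move: h; case: (Num.truncn _) => [_|n h] /=; first by rewrite mulr_gt0.
by rewrite (lt_le_trans _ h) // ltr_nat.
Qed.

Lemma signed_code_approx p k m i j q c :
  grid c.-1 q < entry_norm p k m i j < grid c.+1 q ->
  `|(int_of_code (signed_code (direction_sign k i j) c))%:~R / 2 ^+ q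
    - beta p k m i * direction R k m i j| <= 2 ^- q.
Proof.
rewrite !gridE => /andP[lo hi].
rewrite int_of_signed_code directionE mulrCA [beta _ _ _ _ * _]mulrC.
rewrite -/(entry_norm _ _ _ _ _) rmorphM rmorphXn rmorphN1 -mulrA -mulrBr.
rewrite normrM normrX normrN1 expr1n mul1r ler_norml.
have e_gt0 : 0 < 2 ^- q :> R by rewrite invr_gt0 exprn_gt0.
move: hi; rewrite -natr1 mulrDl mul1r => hi; have y_gt0 := entry_norm_gt0 p k m i j.
case: c lo hi => [|c] /= lo hi.
  by move: hi; rewrite !mul0r => hi; apply/andP; split; lra.
have cE : c%:R / 2 ^+ q = c.+1%:R / 2 ^+ q - 2 ^- q :> R.
  by rewrite -(natr1 c) mulrDl mul1r addrK.
by rewrite cE in lo; rewrite -pmulrn; apply/andP; split; lra.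
Qed.

(** Nonvanishing is searched for as the strict inequality [0 < lam_prod ^ 2], which can be certified
    without knowing the sign. *)
Lemma search_nonvanishing : exists e, forall p phi k, 1 <= p -> represents phi p ->
  ~ even_integer p \/ (k%:R : R) <= p ->
  exists2 m, lam_prod p k m != 0 & eval phi e [:: k] m.
Proof.
have cP : cball 2 (fun (p : R) v => lam_prod p (nth 0%N v 1) (nth 0%N v 0)).
  by apply: cball_lam_prod; exact: cnat_nth.
have [b cb hb] := cball_lt (cball_const R 0 2) (cball_mul cP cP).
have [e he] := eval_search_certified cb; exists e => p phi k p_ge1 hp pk.
have [||m [n [bm ev_m]]] := he phi [:: k] => //.
  have [m nz] := exists_lam_prod_neq0 p_ge1 pk; exists m.
  have [_ /= h] := hb p phi [:: m; k] p_ge1 hp erefl.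
  by apply: h; rewrite -expr2 exprn_even_gt0.
exists m => //; have [/= /(_ n bm) h _] := hb p phi [:: m; k] p_ge1 hp erefl.
by apply: contraTneq h => ->; rewrite mul0r ltxx.
Qed.

Lemma search_bracket : exists e, forall (p : R) phi k m i j q,
  1 <= p -> represents phi p ->
  exists2 c, grid c.-1 q < entry_norm p k m i j < grid c.+1 q &
    eval phi e [:: k; m; i; j; q] c.
Proof.
pose x l (v : seq nat) := nth 0%N v l.
have cx l : cnat 6 (fun _ v => x l v) by exact: cnat_nth.
have cS : cball 6 (fun (p : R) v => scale p (x 1%N v) (x 2%N v)).
  exact: cball_scale.
have cA : cball 6 (fun (p : R) v => `|direction R (x 1%N v) (x 2%N v) (x 3%N v) (x 4%N v)|
    `^ p * alpha p (x 1%N v) (x 2%N v) (x 3%N v)).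
  apply: cball_mul; last exact: cball_alpha.
  apply: cball_powR => [v _|]; first exact: normr_ge0.
  by apply: crat_norm; exact: crat_direction.
have cG F : cnat 6 (fun _ v => F v) ->
    cball 6 (fun (p : R) v => grid (F v) (x 5%N v) `^ p * scale p (x 1%N v) (x 2%N v)).
  move=> cF; apply: cball_mul => //; apply: cball_powR => [v _|].
    exact: grid_ge0.
  exact: crat_grid.
have [b cb hb] := cball_lt (cG _ (cnat_pred (cx 0%N))) cA.
have [b' cb' hb'] := cball_lt cA (cG _ (cnat_S (cx 0%N))).
have [e he] := eval_search_certified (cbool_and cb cb').
exists e => p phi k m i j q p_ge1 hp; have p_gt0 : 0 < p by lra.
have [||c [n [/andP[bc bc'] ev_c]]] := he phi [:: k; m; i; j; q] => //.
  have [c /andP[lo hi]] := exists_grid_bracket p k m i j q; exists c.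
  have [_ /= h] := hb p phi [:: c; k; m; i; j; q] p_ge1 hp erefl.
  have [_ /= h'] := hb' p phi [:: c; k; m; i; j; q] p_ge1 hp erefl.
  have [N hN] := h ((grid_belowP k m i j q c.-1 p_gt0).2 lo).
  have [N' hN'] := h' ((grid_aboveP k m i j q c.+1 p_gt0).2 hi).
  exists (maxn N N') => n; rewrite geq_max => /andP[Nn N'n].
  by rewrite hN ?hN'.
exists c => //.
have [/= /(_ n bc) h _] := hb p phi [:: c; k; m; i; j; q] p_ge1 hp erefl.
have [/= /(_ n bc') h' _] := hb' p phi [:: c; k; m; i; j; q] p_ge1 hp erefl.
apply/andP; split.
  exact: (grid_belowP k m i j q c.-1 p_gt0).1.
exact: (grid_aboveP k m i j q c.+1 p_gt0).1.
Qed.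

Lemma isolating_matrix_program : exists A, forall (p : R) phi k, 1 <= p ->
  represents phi p -> ~ even_integer p \/ k%:R <= p ->
  exists2 m, lam_prod p k m != 0 & outputs_matrix phi A k (isolating_matrix p k m).
Proof.
have [e1 he1] := search_nonvanishing; have [e2 he2] := search_bracket.
have c_code : cnat 5 (fun _ v => signed_code
    (direction_sign (nth 0%N v 1) (nth 0%N v 2) (nth 0%N v 3)) (nth 0%N v 0)).
  have c2 : cnat 5 (fun _ v => 2 * nth 0%N v 0)%N.
    by apply: cnat_mul; [exact: cnat_const|exact: cnat_nth].
  have cx l : cnat 5 (fun _ v => nth 0%N v l) by exact: cnat_nth.
  apply: cnat_if => //; last exact: cnat_pred.
  rewrite /cbool.
  apply: (@cnat_ext _ (fun _ v => if (nth 0%N v 3 < nth 0%N v 1)%N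
    then nat_of_bool (bit (nth 0%N v 2) (nth 0%N v 3))
    else nat_of_bool (0 < popcount (nth 0%N v 1) (nth 0%N v 2))%N)).
    by move=> phi v _; rewrite /direction_sign; case: ifP.
  apply: cnat_if; first exact: (cbool_leq (cnat_S _)).
    exact: cbool_bit.
  by apply: cbool_leq; [exact: cnat_const|exact: cnat_popcount].
(* This search reads only [k] and the oracle, so the same [m] serves every entry and every
   precision. *)
pose em := PComp e1 [:: PProj 0].
have [A hA] := eval_bind
  (PComp e2 [:: PProj 0; em; PProj 1; PProj 2; PProj 3]) c_code.
exists A => p phi k p_ge1 hp pk; have [m P_neq0 ev_m] := he1 p phi k p_ge1 hp pk.
exists m => // i j.
(* Choosing one evaluated bracket for each precision gives the name of the entry. *)
have /choice[c hc] : forall q, exists c,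
    grid c.-1 q < entry_norm p k m i j < grid c.+1 q /\
    eval phi e2 [:: k; m; nat_of_ord i; nat_of_ord j; q] c.
  by move=> q; have [c] := he2 p phi k m i j q p_ge1 hp; exists c.
exists (fun q => signed_code (direction_sign k i j) (c q)); split=> q.
  by rewrite mxE; apply: signed_code_approx; exact: (hc q).1.
apply: (hA phi [:: k; nat_of_ord i; nat_of_ord j; q]) => //.
apply: ev_comp (hc q).2.
have ev_em : eval phi em [:: k; nat_of_ord i; nat_of_ord j; q] m.
  apply: (@ev_comp _ _ _ _ [:: k]) ev_m; apply: evs_cons; last exact: evs_nil.
  exact: (ev_proj phi 0).
apply: evs_cons; first exact: (ev_proj phi 0).
apply: evs_cons; first exact: ev_em.
apply: evs_cons; first exact: (ev_proj phi 1).
apply: evs_cons; first exact: (ev_proj phi 2).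
apply: evs_cons; first exact: (ev_proj phi 3).
exact: evs_nil.
Qed.

End Output.

Theorem theorem3p2 (R : realType) :
  (forall (k : nat) (p : R), (0 < k)%N -> 1 <= p ->
     ((exists (d : nat) (V : 'M[R]_(d, k)) (t : 'cV[R]_d),
         isolating_parallelepiped p V t)
      <-> (~ even_integer p \/ k%:R <= p)))
  /\
  (exists A : prog,
     forall (k : nat) (p : R) (phi : nat -> nat), (0 < k)%N -> 1 <= p ->
       computable phi -> represents phi p ->
       (~ even_integer p \/ k%:R <= p) ->
       exists (V : 'M[R]_((2 ^ k)%N, k)) (t : 'cV[R]_((2 ^ k)%N)),
         isolating_parallelepiped p V t
         /\ outputs_matrix phi A k (row_mx V t)).
Proof.
split=> [k p k_gt0 p_ge1|].
  split=> [[d [V [t Vt]]]|pk].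
    have [even_p|] := pselect (even_integer p); last by left.
    right; rewrite leNgt; apply/negP => pk.
    exact: no_isolating_parallelepiped even_p pk Vt.
  have [m P_neq0] := exists_lam_prod_neq0 p_ge1 pk.
  exists (2 ^ k)%N, (lsubmx (isolating_matrix p k m)),
    (rsubmx (isolating_matrix p k m)).
  exact: isolating_matrixP.
have [A hA] := isolating_matrix_program R; exists A => k p phi _ p_ge1 _ hp pk.
have [m P_neq0 out] := hA p phi k p_ge1 hp pk.
exists (lsubmx (isolating_matrix p k m)), (rsubmx (isolating_matrix p k m)).
by rewrite hsubmxK; split=> //; exact: isolating_matrixP.
Qed.
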